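(* Let $K$ be the Knaster continuum, let $\mathcal{U}$ be a non-principal ultrafilter on $\mathbb{N}$, and let $\mathcal{D}=\{D_n\}_{n\in\mathbb{N}}$, $D_n=\{d_{i,n}\}_{i=1}^{k_n}$, be a sequence of chains covering $K$ such that $(0,0)\in d_{1,n}$ for every $n$ and $\mathrm{mesh}(D_n)\to0$ as $n\to\infty$. Then $K$ with the order topology $\tau_{\mathcal{U}}^{\mathcal{D}}$ generated by the ultrafilter order $\leq_{\mathcal{U}}^{\mathcal{D}}$ is homeomorphic to a disjoint sum of topological spaces $$(K,\tau_{\mathcal{U}}^{\mathcal{D}})\simeq\bigoplus_{i\in I}X_i,$$ where the summands $X_i$ correspond to the arc components of the Knaster continuum (in its original topology): $X_0$ is homeomorphic to the interval $[0,1)$ and corresponds to the arc component of $K$ containing the point $(0,0)$, and all other $X_i$ are homeomorphic to the open interval $(0,1)$ and correspond to the remaining arc components of $K$.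
   Context: A chain in a metric space $X$ is a finite sequence of open sets $d_1,\dots,d_k$ (its links) with $d_i\cap d_j\neq\varnothing\iff|i-j|\le 1$; its mesh is the maximum of the diameters of its links. $\mathbb{N}=\{1,2,3,\dots\}$. Let $\mathcal{D}=\{D_n\}_{n\in\mathbb{N}}$ be a sequence of chains $D_n=\{d_{1,n},\dots,d_{k_n,n}\}$, each covering $X$, with $\mathrm{mesh}(D_n)\to 0$, and let $\mathcal{U}$ be a non-principal ultrafilter on $\mathbb{N}$. Write $x\leq_{D_n}y$ iff there exist $i\le j\le k_n$ with $x\in d_{i,n}$ and $y\in d_{j,n}$, and $x\leq_{\mathcal{U}}^{\mathcal{D}}y$ iff $\{n\in\mathbb{N}: x\leq_{D_n}y\}\in\mathcal{U}$. This is a linear order on $X$, called an ultrafilter order. Let $\mathcal{C}\subseteq[0,1]\times\{0\}$ be the standard Cantor ternary set. The Knaster continuum is the subspace $K$ of $\mathbb{R}^2$ consisting of: all semicircles with ordinates $\ge0$, with center $(\frac12,0)$, passing through points of $\mathcal{C}$; and, for each $n\ge1$, all semicircles with ordinates $\le0$, with center $(\frac{5}{2\cdot3^n},0)$, passing through points of $\mathcal{C}$ lying in the interval $[\frac{2}{3^n},\frac{1}{3^{n-1}}]$. *)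

(* Defs.v *)
From HB Require Import structures.
From mathcomp Require Import all_boot all_order all_algebra.
From mathcomp Require Import all_classical all_reals all_analysis.

Set Implicit Arguments.
Unset Strict Implicit.
Unset Printing Implicit Defensive.

Import Order.TTheory GRing.Theory Num.Theory.
Import numFieldNormedType.Exports.

Local Open Scope classical_set_scope.
Local Open Scope ring_scope.

Definition homeomorphism (S T : topologicalType) (f : S -> T) : Prop :=
  exists g : T -> S,
    [/\ cancel f g, cancel g f, continuous f & continuous g].

Definition homeomorphic (S T : topologicalType) : Prop :=
  exists f : S -> T, homeomorphism f.

Definition is_arc (R : realType) (T : topologicalType) (A : set T) : Prop :=
  homeomorphic (set_type A) (set_type (`[0, 1] : set R)).

(* The disjunct [y = x] makes a point lying on no arc its own arc component. *)
Definition arc_component (R : realType) (T : topologicalType) (x : T) : set T :=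
  [set y | y = x \/ exists A : set T, [/\ is_arc R A, A x & A y]].

Definition arc_components (R : realType) (T : topologicalType) : set (set T) :=
  range (@arc_component R T).

Arguments arc_components : clear implicits.

(* Links are numbered from 0, so the first link is [nth set0 d 0]. *)
Definition is_chain (T : topologicalType) (d : seq (set T)) : Prop :=
  (forall i, (i < size d)%N -> open (nth set0 d i)) /\
  (forall i j, (i < size d)%N -> (j < size d)%N ->
    (nth set0 d i `&` nth set0 d j !=set0 <-> (i <= j.+1)%N && (j <= i.+1)%N)).

Definition chain_covers (T : Type) (d : seq (set T)) : Prop :=
  forall x : T, exists2 i, (i < size d)%N & nth set0 d i x.

Definition diam (R : realType) (T : Type) (dist : T -> T -> R) (A : set T) :
    \bar R :=
  ereal_sup [set z | exists x y, [/\ A x, A y & z = (dist x y)%:E]].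

Definition mesh (R : realType) (T : Type) (dist : T -> T -> R)
    (d : seq (set T)) : \bar R :=
  \big[maxe/0%E]_(A <- d) diam dist A.

Definition chain_le (T : Type) (d : seq (set T)) (x y : T) : Prop :=
  exists i j, [/\ (i <= j)%N, (j < size d)%N, nth set0 d i x & nth set0 d j y].

Definition ultra_le (T : Type) (U : set_system nat) (D : nat -> seq (set T))
    (x y : T) : Prop :=
  U [set n | chain_le (D n) x y].

Definition nonprincipal (U : set_system nat) : Prop :=
  forall n : nat, U <> principal_filter n.

(* The order topology of a linear order given as a bare relation: the subbase
   is that of the library's [order_topology], which needs a bundled
   [orderType], whereas [ultra_le U D] is a linear order only for suitable
   [U] and [D]. *)
Definition order_space (T : Type) (le : T -> T -> Prop) : Type := T.

Section order_space_topology.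
Context {T : choiceType} (le : T -> T -> Prop).

Definition open_rays : set (set T) :=
  [set A | exists a, A = [set x | le x a /\ x <> a] \/
                     A = [set x | le a x /\ x <> a]].

HB.instance Definition _ := Choice.on (order_space le).
HB.instance Definition _ :=
  isSubBaseTopological.Build (order_space le) open_rays id.

End order_space_topology.

Section knaster.
Variable R : realType.

Fixpoint cantor_step (n : nat) : set R :=
  if n is m.+1 then
    [set x / 3 | x in cantor_step m] `|` [set (x + 2) / 3 | x in cantor_step m]
  else `[0, 1].

Definition cantor_ternary : set R := \bigcap_n cantor_step n.

(* The library metric on [R * R] is the max metric; it induces the same
   topology as this one. *)
Definition edist (p q : R * R) : R :=
  Num.sqrt ((p.1 - q.1) ^+ 2 + (p.2 - q.2) ^+ 2).

Definition same_circle (m c : R) (p : R * R) : Prop :=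
  edist p (m, 0) = edist (c, 0) (m, 0).

Definition knaster_upper : set (R * R) :=
  [set p | 0 <= p.2 /\ exists2 c, cantor_ternary c & same_circle (1 / 2) c p].

Definition knaster_lower (n : nat) : set (R * R) :=
  [set p | p.2 <= 0 /\ exists c,
    [/\ cantor_ternary c, 2 / 3 ^+ n <= c <= 1 / 3 ^+ n.-1 &
        same_circle (5 / (2 * 3 ^+ n)) c p]].

Definition knaster_set : set (R * R) :=
  knaster_upper `|` \bigcup_(n in [set n | (0 < n)%N]) knaster_lower n.

(* [set_type] carries the subspace topology. *)
Definition knaster : topologicalType := set_type knaster_set.

Definition knaster_dist (x y : knaster) : R := edist (val x) (val y).

Lemma knaster_set0 : (0, 0) \in knaster_set.
Proof.
apply/mem_set; left; split=> //=; exists 0 => // n _.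
by elim: n => [|n IHn]; [rewrite /= in_itv /= lexx ler01|left; exists 0; rewrite ?mul0r].
Qed.

Definition knaster0 : knaster := exist _ (0, 0) knaster_set0.

End knaster.

(* Main.v *)
Require Import Defs.
From HB Require Import structures.
From mathcomp Require Import all_boot all_order all_algebra.
From mathcomp Require Import all_classical all_reals all_analysis.
From mathcomp Require Import lra zify ring finmap.

Set Implicit Arguments.
Unset Strict Implicit.
Unset Printing Implicit Defensive.

Import Order.TTheory GRing.Theory Num.Theory.
Import numFieldNormedType.Exports.

Local Open Scope classical_set_scope.
Local Open Scope ring_scope.

(** The ultrafilter order restricted to an arc component of the continuum is an
    interval, and the order topology separates these intervals.

    The starting point is that closed connected sets, and in particular arcs, are
    convex for the ultrafilter order (connected_ultra_convex): when w lies between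
    two points of A along infinitely many chains of small mesh, either w is a limit
    of points of A, or the links through w cut A into two parts. Everything else about the
    order restricted to components follows from this convexity. On an arc the order is
    one of the two natural orders of the arc (path_increasing), order intervals
    between points of a component are subarcs, and arc components are convex and
    form a partition (joined_trans). An arc component is a countable union of
    such intervals because the continuum is metric (countable_cofinal), so it is
    order isomorphic to an interval of real numbers, and only the presence of extremal
    points remains to be decided.

    This is where the Knaster continuum enters, through a single property. The origin
    is the minimum for the order, as it is on the first links. Any other point is
    strictly inside a semicircle or is a common end point of an upper and a lower
    semicircle (knaster_two_sided), hence is strictly between two points of
    its component. So the component of the origin is a copy of [0, 1[ and the other ones
    are copies of ]0, 1[ (component_ray, component_line).

    Finally each component is convex and has no extremal point except for the minimum
    of the whole order, so it is open in the order topology, and the space is the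
    disjoint sum of its components (sum_of_intervals_homeo). *)

(** * Arcs as images of paths *)

Definition in_set (T : Type) (A : set T) (x : T) (Ax : A x) : set_type A :=
  exist _ x (mem_set Ax).

Lemma continuous_set_type (S T : topologicalType) (A : set T)
    (f : S -> set_type A) :
  continuous (fun x => val (f x)) -> continuous f.
Proof. by move=> cf; apply: continuous_comp_initial => x; exact: cf. Qed.

Lemma continuous_val (T : topologicalType) (A : set T) :
  continuous (val : set_type A -> T).
Proof. exact: initial_continuous. Qed.

(** A closed set of a subspace is the trace of a closed set; the inverse of a path
    is shown to be continuous by pulling back closed sets. *)
Lemma closed_set_type (T : topologicalType) (A : set T) (C : set (set_type A)) :
  closed C -> exists2 C' : set T, closed C' & C = val @^-1` C'.
Proof.
move=> cC; have [V oV VC] : open (~` C) by exact: closed_openC.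
exists (~` V); first exact: open_closedC.
by rewrite -[LHS]setCK -VC.
Qed.

Section arcs.
Context {R : realType} {T : topologicalType}.
Implicit Types (g : R -> T) (A : set T) (t u v : R).

(** The retraction of the line onto [u, v]; composing with it turns paths defined
    on an interval into paths defined on the whole line, so that every path below
    is a plain continuous function. *)
Definition clamp u v t : R := Num.max u (Num.min v t).

Lemma clamp_itv u v t : u <= v -> u <= clamp u v t <= v.
Proof.
by move=> uv; rewrite /clamp le_max lexx/= ge_max uv/= ge_min lexx.
Qed.

Lemma clamp_id u v t : u <= t <= v -> clamp u v t = t.
Proof. by move=> /andP[ut tv]; rewrite /clamp min_r// max_r. Qed.

Lemma clamp_continuous u v : continuous (clamp u v).
Proof.
move=> t; apply: (@continuous_max _ _ (cst u) (fun t => Num.min v t)).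
  exact: cst_continuous.
by apply: (@continuous_min _ _ (cst v) id); [exact: cst_continuous|].
Qed.

Definition inj_on u v g := forall s t,
  u <= s <= v -> u <= t <= v -> g s = g t -> s = t.

Lemma affine_continuous (a b : R) : continuous (fun t : R => a + t * b).
Proof.
move=> t; apply: (@continuousD _ _ _ (cst a) (fun t => t * b)).
  exact: cst_continuous.
by apply: (@continuousM _ _ id (cst b)); [|exact: cst_continuous].
Qed.

(** An injective path on a compact interval is a homeomorphism onto its image: it
    maps closed sets to compact sets, which are closed in a Hausdorff space. *)
Lemma is_arc_path g u v : hausdorff_space T -> u < v -> continuous g ->
  inj_on u v g -> is_arc R (g @` `[u, v]).
Proof.
move=> hT uv cg ig; set A := g @` _.
pose d t := g (u + t * (v - u)).
have cd : continuous d.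
  by move=> t; apply: continuous_comp; [exact: affine_continuous|exact: cg].
have AE t : `[0, 1]%classic t -> A (d t).
  rewrite /= in_itv/= => /andP[t0 t1]; exists (u + t * (v - u)) => //=.
  by rewrite in_itv/=; apply/andP; split; nra.
have EA x : A x -> exists t : set_type (`[0, 1] : set R), d (val t) = x.
  move=> [s /=]; rewrite in_itv/= => /andP[us sv] <-.
  have t01 : `[0, 1]%classic ((s - u) / (v - u)).
    rewrite /= in_itv/= divr_ge0 ?subr_ge0// ?(ltW uv)//=.
    by rewrite ler_pdivrMr ?subr_gt0// mul1r lerB.
  exists (in_set t01) => /=; rewrite /d divfK ?subr_eq0 ?gt_eqF//.
  by congr g; lra.
have d_inj (s t : set_type (`[0, 1] : set R)) : d (val s) = d (val t) -> s = t.
  have := set_valP s; have := set_valP t; rewrite /= !in_itv/=.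
  move=> /andP[t0 t1] /andP[s0 s1] /ig H; apply/val_inj.
  have vu : v - u != 0 by rewrite subr_eq0 gt_eqF.
  apply: (mulIf vu); apply: (addrI u); apply: H; apply/andP; split; nra.
pose G (t : set_type (`[0, 1] : set R)) : set_type A :=
  in_set (AE _ (set_valP t)).
have [F FG] : exists F : set_type A -> set_type (`[0, 1] : set R),
    forall x, d (val (F x)) = val x.
  have [F FG] := choice (fun x : set_type A => EA _ (set_valP x)).
  by exists F.
exists F, G; split.
- by move=> x; apply/val_inj => /=; exact: FG.
- by move=> t; apply: d_inj; rewrite FG.
- apply/continuous_closedP => C /closed_set_type[C' cC' ->].
  have : closed (d @` (C' `&` `[0, 1])).
    apply: compact_closed => //; apply: continuous_compact.
      exact: continuous_subspaceT.
    rewrite setIC; apply: compact_closedI => //; exact: segment_compact.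
  have /continuous_closedP cv := @continuous_val T A.
  move=> /cv; congr closed.
  rewrite predeqE => x; split=> /=.
    move=> [t [C't t01] dt]; 
    suff -> : F x = @in_set _ `[0, 1]%classic _ t01 by [].
    by apply: d_inj; rewrite FG.
  by move=> C'x; exists (val (F x)); [split=> //; exact: (set_valP (F x))|exact: FG].
- apply: continuous_set_type => t /=.
  have cv := @continuous_val R `[0, 1]%classic t.
  exact: (continuous_comp cv (cd _)).
Qed.

(** Every arc has a parametrization defined on the whole line, obtained by clamping
    the argument to [0, 1]. *)
Lemma is_arcP A : is_arc R A ->
  exists2 g, continuous g & inj_on 0 1 g /\ A = g @` `[0, 1].
Proof.
move=> [F [G [FG GF _ cG]]].
have m t : `[0, 1]%classic (clamp 0 1 t).
  by rewrite /= in_itv/= clamp_itv.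
exists (fun t => val (G (in_set (m t)))).
  move=> t; have cm : continuous (fun t => in_set (m t)).
    by apply: continuous_set_type => /=; exact: clamp_continuous.
  exact: (continuous_comp (continuous_comp (cm t) (cG _))
                          (@continuous_val _ _ _)).
split.
  move=> s t s01 t01 /val_inj/(can_inj GF)/(congr1 val)/=.
  by rewrite !clamp_id.
rewrite predeqE => x; split => [Ax|[t _ <-]]; last exact: set_valP.
pose x' : set_type A := in_set Ax.
exists (val (F x')); first exact: set_valP.
rewrite -[RHS]/(val x') -[in RHS](FG x'); congr (val (G _)).
apply/val_inj => /=; rewrite clamp_id//.
by have := set_valP (F x'); rewrite /= in_itv.
Qed.

Lemma path_closed g u v : hausdorff_space T -> continuous g ->
  closed (g @` `[u, v]).
Proof.
move=> hT cg; apply: compact_closed => //; apply: continuous_compact.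
  exact: continuous_subspaceT.
exact: segment_compact.
Qed.

Lemma path_connected g u v : continuous g -> connected (g @` `[u, v]).
Proof.
move=> cg; apply: connected_continuous_connected.
  exact: segment_connected.
exact: continuous_subspaceT.
Qed.

End arcs.

(** * The order defined by an ultrafilter and a sequence of chains *)

Definition linear_order (T : Type) (le : T -> T -> Prop) : Prop :=
  [/\ forall x, le x x,
      forall x y, le x y -> le y x -> x = y,
      forall x y z, le x y -> le y z -> le x z &
      forall x y, le x y \/ le y x].

Lemma nonprincipal_cofinite (U : set_system nat) :
  UltraFilter U -> nonprincipal U -> forall A, (\forall n \near \oo, A n) -> U A.
Proof.
move=> UU npU A [N _ NA].
have UN1 n : U (~` [set n]).
  have [Un|//] := in_ultra_setVsetC [set n] UU; exfalso; apply: (npU n).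
  apply: (@max_filter _ _ (principal_filter_ultra n)) => B /principal_filterP Bn.
  by apply: filterS Un => _ ->.
apply: (@filterS _ _ _ (fun n => (N <= n)%N)) => //.
elim: N {NA} => [|N IH]; first exact: filterE.
by apply: filterS (filterI (UN1 N) IH) => n [/= /eqP nN]; rewrite ltn_neqAle eq_sym nN.
Qed.

(** What remains of mesh(D n) -> 0 once the metric is forgotten. This form is enough
    for the whole study of the ultrafilter order. *)
Definition shrinking (T : topologicalType) (D : nat -> seq (set T)) : Prop :=
  forall (x : T) V, nbhs x V -> \forall n \near \oo,
    forall i, (i < size (D n))%N -> nth set0 (D n) i x -> nth set0 (D n) i `<=` V.

Section ultra_order.
Context {T : topologicalType} (hT : hausdorff_space T).
Variables (U : set_system nat) (D : nat -> seq (set T)).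
Hypothesis UU : UltraFilter U.
Hypothesis U_cofinite : forall A, (\forall n \near \oo, A n) -> U A.
Hypothesis D_chain : forall n, is_chain (D n).
Hypothesis D_cover : forall n, chain_covers (D n).
Hypothesis D_shrink : shrinking D.

Local Notation link n i := (nth set0 (D n) i).

(** Distinct points have disjoint neighbourhoods, and for most n all links through
    the one or the other lie inside these; so no link through x meets a link
    through y, which for a chain means that their indices differ by at least two. *)
Lemma far_links x y : x <> y -> U [set n | forall i j,
  (i < size (D n))%N -> (j < size (D n))%N -> link n i x -> link n j y ->
  (i.+1 < j)%N || (j.+1 < i)%N].
Proof.
move=> /eqP xy; have := hT; rewrite open_hausdorff => /(_ x y xy).
move=> [[V W]/= [/set_mem Vx /set_mem Wy] [oV oW /eqP VW]].
have Ux := U_cofinite (D_shrink (open_nbhs_nbhs (conj oV Vx))).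
have Uy := U_cofinite (D_shrink (open_nbhs_nbhs (conj oW Wy))).
apply: filterS (filterI Ux Uy) => n [/= nV nW] i j ilt jlt ix jy.
have [_ /(_ i j ilt jlt)[_ meet]] := D_chain n.
rewrite !ltnNge -negb_and andbC; apply/negP => /meet[z [iz jz]].
suff : set0 z by [].
by rewrite -VW; split; [exact: nV iz|exact: nW jz].
Qed.

Lemma common_links n i j x : (i < size (D n))%N -> (j < size (D n))%N ->
  link n i x -> link n j x -> (i <= j.+1)%N && (j <= i.+1)%N.
Proof.
move=> ilt jlt ix jx; have [_ /(_ i j ilt jlt)[+ _]] := D_chain n.
by apply; exists x.
Qed.

Lemma ultra_le_linear : linear_order (ultra_le U D).
Proof.
split.
- move=> x; rewrite /ultra_le; apply: filterE => n.
  by have [i ilt ix] := D_cover n x; exists i, i.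
- move=> x y xy yx; apply: contrapT => /far_links Uxy.
  (* The indices satisfy i + 1 < j and k + 1 < l, while |i - l| <= 1 and
     |j - k| <= 1, as these links share x and y respectively. *)
  have [n [[[i [j [ij jlt ix jy]]] [k [l [kl llt ky lx]]]] far]] :=
    filter_ex (filterI (filterI xy yx) Uxy).
  have ilt := leq_ltn_trans ij jlt; have klt := leq_ltn_trans kl llt.
  have := common_links ilt llt ix lx; have := common_links jlt klt jy ky.
  by have := far _ _ ilt jlt ix jy; have := far _ _ llt klt lx ky; lia.
- move=> x y z xy yz.
  have [->//|/far_links Uxy] := pselect (x = y).
  have [<-//|/far_links Uyz] := pselect (y = z).
  apply: filterS (filterI (filterI xy yz) (filterI Uxy Uyz)) => n.
  move=> [[[i [j [ij jlt ix jy]]] [k [l [kl llt ky lz]]]] [farxy faryz]].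
  have ilt := leq_ltn_trans ij jlt; have klt := leq_ltn_trans kl llt.
  exists i, l; split=> //; have := common_links jlt klt jy ky.
  by have := farxy _ _ ilt jlt ix jy; have := faryz _ _ klt llt ky lz; lia.
- move=> x y; have [|Uc] := in_ultra_setVsetC [set n | chain_le (D n) x y] UU.
    by left.
  right; apply: filterS Uc => n nxy.
  have [i ilt ix] := D_cover n x; have [j jlt jy] := D_cover n y.
  have [ij|ji] := leqP i j; first by exfalso; apply: nxy; exists i, j.
  by exists j, i; split=> //; exact: ltnW.
Qed.

(** The key to the theorem. If w is outside A, then for most n the links through w
    miss A. Since w lies between x and y along the chain, the links before those
    of w and the links after them are two disjoint open sets that cover A and both
    meet A, so A is not connected. *)
Lemma connected_ultra_convex (A : set T) x y w : closed A -> connected A ->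
  A x -> A y -> ultra_le U D x w -> ultra_le U D w y -> A w.
Proof.
move=> cA conA Ax Ay xw wy; apply: contrapT => nAw.
have Uw := U_cofinite (D_shrink (open_nbhs_nbhs (conj (closed_openC cA) nAw))).
have [n [[[i [j [ij jlt ix jw]]] [k [l [kl llt kw ly]]]] /= missA]] :=
  filter_ex (filterI (filterI xw wy) Uw).
have jA z : link n j z -> ~ A z by exact: missA.
have kA z : link n k z -> ~ A z by apply: missA => //; exact: leq_ltn_trans llt.
have ij' : (i < j)%N.
  by rewrite ltn_neqAle ij andbT; apply: contraPneq Ax => ijE; apply: jA; rewrite -ijE.
have jl' : (j < l)%N.
  have := common_links jlt (leq_ltn_trans kl llt) jw kw.
  have jl : j <> l by move=> jlE; apply: (jA y) => //; rewrite jlE.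
  have kl' : k <> l by move=> klE; apply: (kA y) => //; rewrite klE.
  by lia.
pose before := \bigcup_(m in [set m | (m < j)%N]) link n m.
pose after := \bigcup_(m in [set m | (j < m < size (D n))%N]) link n m.
have [lo meet] := D_chain n.
have ob : open before.
  apply: bigcup_open => m /= mj; apply: lo; exact: ltn_trans jlt.
have oa : open after by apply: bigcup_open => m /= /andP[_ mlt]; exact: lo.
have ba z : before z -> ~ after z.
  move=> [m /= mj mz] [m' /= /andP[jm' m'lt] m'z].
  by have := common_links (ltn_trans mj jlt) m'lt mz m'z; lia.
have bVa z : A z -> before z \/ after z.
  move=> Az; have [m mlt mz] := D_cover n z.
  have [mj|jm|mj] := ltngtP m j; first by left; exists m.
    by right; exists m => //=; rewrite jm.
  by exfalso; apply: (jA z) => //; rewrite -mj.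
have AB : A `&` before = A.
  apply: conA.
  - by exists x; split=> //; exists i.
  - by exists before.
  - exists (~` after); first exact: open_closedC.
    rewrite predeqE => z; split=> -[Az]; first by move=> /ba.
    by move=> /= na; split=> //; have [] := bVa z Az.
have : (A `&` before) y by rewrite AB.
by move=> [_ /ba]; apply; exists l => //=; rewrite jl'.
Qed.

End ultra_order.

(** * Linear orders given as relations *)

Definition strict (T : Type) (le : T -> T -> Prop) (x y : T) : Prop :=
  le x y /\ x <> y.

Definition increasing_on (R : realType) (T : Type) (le : T -> T -> Prop)
    (I : set R) (g : R -> T) : Prop :=
  forall s t, I s -> I t -> s < t -> strict le (g s) (g t).

Section linear_orders.
Context {T : Type} {le : T -> T -> Prop} (lin : linear_order le).
Local Notation lt := (strict le).

Lemma lin_refl x : le x x. Proof. by case: lin. Qed.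

Lemma lin_anti x y : le x y -> le y x -> x = y.
Proof. by case: lin => _ + _ _; apply. Qed.

Lemma lin_trans y x z : le x y -> le y z -> le x z.
Proof. by case: lin => _ _ + _; apply. Qed.

Lemma lin_total x y : le x y \/ le y x. Proof. by case: lin. Qed.

Lemma lin_leP x y : le x y \/ lt y x.
Proof.
have [|yx] := lin_total x y; first by left.
have [->|xy] := pselect (x = y); first by left; exact: lin_refl.
by right; split=> // yxE; apply: xy.
Qed.

Lemma lin_lt_le x y : lt x y -> ~ le y x.
Proof. by move=> [xy nxy] yx; apply/nxy/lin_anti. Qed.

Lemma lin_le_lt_trans y x z : le x y -> lt y z -> lt x z.
Proof.
move=> xy yz; split; first by exact: lin_trans xy yz.1.
by move=> xz; apply: (lin_lt_le yz); rewrite -xz.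
Qed.

Lemma lin_lt_le_trans y x z : lt x y -> le y z -> lt x z.
Proof.
move=> xy yz; split; first by exact: lin_trans xy.1 yz.
by move=> xz; apply: (lin_lt_le xy); rewrite xz.
Qed.

Lemma linear_order_flip : linear_order (fun x y => le y x).
Proof.
split; [exact: lin_refl|by move=> x y yx xy; exact: lin_anti| |].
  by move=> x y z yx zy; exact: lin_trans zy yx.
by move=> x y; exact: lin_total.
Qed.

Lemma increasing_on_inj (R : realType) (I : set R) (g : R -> T) s t :
  increasing_on le I g -> I s -> I t -> g s = g t -> s = t.
Proof.
move=> gI Is It gst; have [st|ts|//] := ltgtP s t.
  by have [_ /(_ gst)] := gI _ _ Is It st.
by have [_ /(_ (esym gst))] := gI _ _ It Is ts.
Qed.

Lemma increasing_on_lt (R : realType) (I : set R) (g : R -> T) s t :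
  increasing_on le I g -> I s -> I t -> lt (g s) (g t) -> s < t.
Proof.
move=> gI Is It gst; have [//|ts|stE] := ltgtP s t.
  by have /lin_lt_le := gI _ _ It Is ts; case: gst.
by case: gst; rewrite stE.
Qed.

End linear_orders.

(** * Arc components under an order with convex arcs *)

(** Arcs are closed and connected, so they are convex for such an order; the order
    structure of arc components follows from this alone. *)
Definition arc_convex (T : topologicalType) (le : T -> T -> Prop) : Prop :=
  forall (A : set T) x y w, closed A -> connected A -> A x -> A y ->
    le x w -> le w y -> A w.

Section arcs_and_orders.
Context {R : realType} {T : topologicalType} (hT : hausdorff_space T).
Context {le : T -> T -> Prop} (lin : linear_order le) (conv : arc_convex le).
Local Notation lt := (strict le).
Implicit Types (g : R -> T) (x y z w : T).

Lemma path_between g s t w : continuous g ->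
  (le (g s) w /\ le w (g t)) \/ (le (g t) w /\ le w (g s)) ->
  s <= t -> exists2 r, s <= r <= t & g r = w.
Proof.
move=> cg btw st.
suff [r rst <-] : (g @` `[s, t]) w by exists r => //; move: rst; rewrite /= in_itv.
have gs : (g @` `[s, t]) (g s) by exists s => //=; rewrite in_itv/= lexx.
have gt : (g @` `[s, t]) (g t) by exists t => //=; rewrite in_itv/= lexx st.
have cl := path_closed (u := s) (v := t) hT cg.
have co := path_connected (u := s) (v := t) cg.
by case: btw => -[]; exact: conv.
Qed.

(** An arc carries its own betweenness relation: of three of its points, the middle
    one is the only one that is on the subarc spanned by the other two.
    As subarcs are convex, the order of the space induces the same betweenness,
    hence one of the two natural orders of the arc. *)
Lemma path_increasing g u v : continuous g -> inj_on u v g ->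
  lt (g u) (g v) -> increasing_on le `[u, v] g.
Proof.
move=> cg ig guv.
have from_u t : u <= t <= v -> le (g u) (g t).
  move=> /andP[ut tv]; have [//|gtu] := lin_leP lin (g u) (g t).
  have [|r /andP[tr rv] gr] := @path_between g t v (g u) cg _ tv.
    by left; split; [exact: gtu.1|exact: guv.1].
  case: gtu => _ []; rewrite -gr; congr g; apply/eqP; rewrite eq_le tr/=.
  have ru : r = u by apply: ig; rewrite // ?lexx ?(le_trans ut tr)// (le_trans ut tv).
  by rewrite ru.
move=> s t /=; rewrite !in_itv/= => sI tI st.
have [gts|//] := lin_leP lin (g t) (g s).
have /andP[us _] := sI.
have [|r /andP[ur rs] gr] := @path_between g u s (g t) cg _ us.
  by left; split=> //; exact: from_u.
have rt : r = t by apply: ig; rewrite // ur (le_trans rs)//; case/andP: sI.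
by move: st; rewrite -rt ltNge rs.
Qed.

(** The order interval [x, y] is an arc, parametrized increasingly. This is stronger
    than lying on a common arc: nothing of the order interval is left out. *)
Definition segment_chart x y g : Prop :=
  [/\ continuous g, increasing_on le `[0, 1] g, g 0 = x, g 1 = y &
      forall w, le x w -> le w y -> exists2 t, 0 <= t <= 1 & g t = w].

(** The subarc from x to y is both convex and made of points between x and y. *)
Lemma arc_segment_chart A x y : is_arc R A -> A x -> A y -> lt x y ->
  exists g, segment_chart x y g.
Proof.
move=> /is_arcP[g cg [ig ->]] [s sI gs] [t tI gt] xy.
move: sI tI; rewrite /= !in_itv/= => sI tI.
have st : t - s != 0.
  by rewrite subr_eq0; apply: contra_notN xy.2 => /eqP st; rewrite -gs -gt st.
pose d r := g (s + r * (t - s)).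
have cd : continuous d.
  by move=> r; apply: continuous_comp; [exact: affine_continuous|exact: cg].
have d0 : d 0 = x by rewrite /d mul0r addr0.
have d1 : d 1 = y by rewrite /d mul1r addrC subrK.
have d_inj : inj_on 0 1 d.
  move=> a b /andP[a0 a1] /andP[b0 b1] /ig H.
  case/andP: sI tI => s0 s1 /andP[t0 t1].
  by apply: (mulIf st); apply: (addrI s); apply: H; apply/andP; split; nra.
exists d; split=> //; first by apply: path_increasing; rewrite // d0 d1.
by move=> w xw wy; apply: path_between => //; left; rewrite d0 d1.
Qed.

Lemma segment_chart_is_arc x y g : segment_chart x y g ->
  [/\ is_arc R (g @` `[0, 1]), (g @` `[0, 1]) x & (g @` `[0, 1]) y].
Proof.
move=> [cg gI gx gy _]; split.
- apply: is_arc_path => // s t sI tI.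
  by apply: (increasing_on_inj gI); rewrite /= in_itv.
- by exists 0; rewrite //= in_itv/= lexx ler01.
- by exists 1; rewrite //= in_itv/= lexx ler01.
Qed.

Lemma continuous_glue (g1 g2 : R -> T) c : continuous g1 -> continuous g2 ->
  g1 c = g2 c -> continuous (fun t => if t <= c then g1 t else g2 t).
Proof.
move=> c1 c2 g12 t V /= nV.
have {}c1 : nbhs (g1 t) V -> \forall s \near t, V (g1 s) by exact: c1.
have {}c2 : nbhs (g2 t) V -> \forall s \near t, V (g2 s) by exact: c2.
suff : \forall s \near t, V (if s <= c then g1 s else g2 s) by [].
move: nV; have [tc|ct|tc] := ltgtP t c => nV.
- have lt_c : \forall s \near t, s < c by exact: lt_nbhsl.
  by apply: filterS2 (c1 nV) lt_c => s /= Vs /ltW ->.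
- have gt_c : \forall s \near t, c < s by exact: lt_nbhsr.
  by apply: filterS2 (c2 nV) gt_c => s /= Vs; rewrite ltNge => /negbTE ->.
- have nV2 : nbhs (g2 t) V by rewrite tc -g12 -tc.
  by apply: filterS2 (c1 nV) (c2 nV2) => s /= V1 V2; case: ifP.
Qed.

(** Increasing arcs from x to y and from y to z meet only at y, so their
    concatenation is again an increasing arc. *)
Lemma segment_chart_cat x y z g1 g2 :
  segment_chart x y g1 -> segment_chart y z g2 -> exists g, segment_chart x z g.
Proof.
move=> [c1 i1 g10 g11 s1] [c2 i2 g20 g21 s2].
(* The affine changes of parameter are written a + t * b to match the continuity
     lemma on affine maps. *)
pose l t := g1 (0 + t * 2); pose r t := g2 (- 1 + t * 2).
have half : 1 / 2 * 2 = 1 :> R by rewrite divfK// pnatr_eq0.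
exists (fun t => if t <= 1 / 2 then l t else r t); split.
- apply: continuous_glue.
  + by move=> t; apply: continuous_comp; [exact: affine_continuous|exact: c1].
  + by move=> t; apply: continuous_comp; [exact: affine_continuous|exact: c2].
  + by rewrite /l /r half add0r addNr g11 g20.
- move=> s t /=; rewrite !in_itv/= => /andP[s0 s1'] /andP[t0 t1] st.
  have ly u : 0 <= u -> u <= 1 / 2 -> le (l u) y.
    move=> u0 u1; rewrite /l -g11; have [->|u12] := eqVneq (0 + u * 2) 1.
      exact: (lin_refl lin _).
    apply: (i1 _ _ _ _ _).1; rewrite /= ?in_itv/= ?lexx ?ler01//.
      by apply/andP; split; lra.
    by rewrite lt_neqAle u12/=; lra.
  have yr u : 1 / 2 < u -> u <= 1 -> lt y (r u).
    move=> u0 u1; rewrite /r -g20.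
    by apply: i2; rewrite /= ?in_itv/= ?lexx ?ler01//; [apply/andP; split|]; lra.
  have [s12|s12] := leP s (1 / 2); have [t12|t12] := leP t (1 / 2).
  + by apply: i1; rewrite /= ?in_itv/=; [apply/andP; split|apply/andP; split|]; lra.
  + by apply: (lin_le_lt_trans lin (y := y)); [exact: ly|exact: yr].
  + by move: st; rewrite ltNge (le_trans t12 (ltW s12)).
  + by apply: i2; rewrite /= ?in_itv/=; [apply/andP; split|apply/andP; split|]; lra.
- by rewrite divr_ge0 ?ler01//= /l mul0r addr0 g10.
- rewrite ifF; last by apply/negbTE; rewrite -ltNge; lra.
  by rewrite /r -g21; congr g2; lra.
- move=> w xw wz; have [wy|yw] := lin_total lin w y.
    have [t /andP[t0 t1] <-] := s1 _ xw wy; exists (t / 2).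
      by apply/andP; split; lra.
    by rewrite ifT /l; [congr g1|]; lra.
  have [t /andP[t0 t1] <-] := s2 _ yw wz.
  have [->|tn0] := eqVneq t 0.
    exists (1 / 2); first by apply/andP; split; lra.
    by rewrite lexx /l half add0r g11 g20.
  have {t0 tn0}t0 : 0 < t by rewrite lt_neqAle eq_sym tn0.
  exists ((1 + t) / 2); first by apply/andP; split; lra.
  rewrite ifF; first by rewrite /r; congr g2; lra.
  by apply/negbTE; rewrite -ltNge; lra.
Qed.

Local Notation joined := (arc_component R).

Lemma joined_refl x : joined x x. Proof. by left. Qed.

Lemma joined_sym x y : joined x y -> joined y x.
Proof. by move=> [->|[A [aA Ax Ay]]]; [left|right; exists A]. Qed.

Lemma joined_chartP x y : lt x y ->
  joined x y <-> exists g, segment_chart x y g.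
Proof.
move=> xy; split.
  move=> [yx|[A [aA Ax Ay]]]; first by case: xy; rewrite yx.
  exact: arc_segment_chart aA Ax Ay xy.
by move=> [g /segment_chart_is_arc[]]; right; exists (g @` `[0, 1]).
Qed.

Lemma is_arc_convex A x y w :
  is_arc R A -> A x -> A y -> le x w -> le w y -> A w.
Proof.
move=> /is_arcP[g cg [_ ->]] Ax Ay xw wy.
by apply: (conv (x := x) (y := y)) => //; [exact: path_closed|exact: path_connected].
Qed.

Lemma joined_convex x y w : joined x y -> le x w -> le w y ->
  joined x w /\ joined w y.
Proof.
move=> [->|[A [aA Ax Ay]]] xw wy.
  by rewrite (lin_anti lin wy xw); split; left.
have Aw := is_arc_convex aA Ax Ay xw wy.
by split; right; exists A.
Qed.

(** Two arcs that share a point may cross many times, so that their union need not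
    be an arc. The order removes the difficulty: if y is between x and z, the order
    intervals [x, y] and [y, z] are arcs that can be concatenated, and otherwise one
    of the two given arcs contains all three points by convexity. *)
Lemma joined_trans x y z : joined x y -> joined y z -> joined x z.
Proof.
have mid a b c : lt a b -> lt b c -> joined a b -> joined b c -> joined a c.
  move=> ab bc /(joined_chartP ab)[g1 c1] /(joined_chartP bc)[g2 c2].
  apply/joined_chartP; first exact: lin_lt_le_trans bc.1.
  exact: segment_chart_cat c1 c2.
have [->//|xy] := pselect (x = y); have [<-//|yz] := pselect (y = z).
move=> jxy jyz; have [lexy|leyx] := lin_total lin x y;
    have [leyz|lezy] := lin_total lin y z.
- exact: (@mid x y z).
- have [xz|zx] := lin_total lin x z.
    by have [] := joined_convex jxy xz lezy.
  by apply: joined_sym; have [] := joined_convex (joined_sym jyz) zx lexy.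
- have [xz|zx] := lin_total lin x z.
    by have [] := joined_convex jyz leyx xz.
  by apply: joined_sym; have [] := joined_convex (joined_sym jxy) leyz zx.
- by apply: joined_sym; apply: (@mid z y x); rewrite /strict;
    [split=> // /esym|split=> // /esym|exact: joined_sym|exact: joined_sym].
Qed.

(** Hence arc components partition the space. *)
Lemma joinedP x y : joined x y <-> joined x = joined y.
Proof.
split=> [xy|->]; last exact: joined_refl.
rewrite predeqE => z; split; last exact: joined_trans.
by apply: joined_trans; exact: joined_sym.
Qed.

End arcs_and_orders.

Arguments segment_chart {R T} le x y g.

(** * Countable cofinality of arc components *)

(** Reversing the order turns statements on upper ends of components into statements
    on lower ends. *)
Lemma arc_convex_flip (T : topologicalType) (le : T -> T -> Prop) :
  arc_convex le -> arc_convex (fun x y => le y x).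
Proof. by move=> conv A x y w cA coA Ax Ay wx yw; exact: (conv A y x w). Qed.

Section cofinality.
Context {R : realType} {T : topologicalType} (hT : hausdorff_space T).
Context {le : T -> T -> Prop} (lin : linear_order le) (conv : arc_convex le).
Context {V : normedModType R} (j : T -> V).
Hypotheses (cj : continuous j) (ij : injective j).
Local Notation lt := (strict le).
Local Notation joined := (arc_component R).

(** A bounded increasing sequence runs along a single arc, so its parameters converge,
    and so does its image in the normed space. *)
Lemma bounded_small_step (a : nat -> T) b e :
  (forall n, le (a n) (a n.+1)) -> (forall n, le (a n) b) ->
  joined (a 0%N) b -> 0 < e -> exists n, `|j (a n.+1) - j (a n)| < e.
Proof.
move=> ai ab jab e0; have [ab0|a0b] := pselect (a 0%N = b).
  exists 0%N; suff -> : a 1%N = a 0%N by rewrite subrr normr0.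
  by apply: (lin_anti lin); [rewrite ab0; exact: ab|exact: ai].
have [g [cg gI g0 g1 gs]] := (joined_chartP hT lin conv (conj (ab 0%N) a0b)).1 jab.
have a0a n : le (a 0%N) (a n).
  by elim: n => [|n IH]; [exact: (lin_refl lin _)|exact: (lin_trans lin IH (ai n))].
have [t tE] := choice (fun n => let: ex_intro2 r r01 gr := gs _ (a0a n) (ab n) in
   ex_intro (fun r => 0 <= r <= 1 /\ g r = a n) r (conj r01 gr)).
have ti : nondecreasing_seq t.
  apply/nondecreasing_seqP => n; rewrite leNgt; apply/negP => tn.
  have [tI gt] := tE n; have [tI' gt'] := tE n.+1.
  have := gI _ _ _ _ tn; rewrite /= !in_itv/= gt gt' => /(_ tI' tI).
  by move=> /(lin_lt_le lin); apply; exact: ai.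
have /cvg_ex[l tl] : cvgn t.
  apply: nondecreasing_is_cvgn => //; exists 1 => _ [n _ <-].
  by have [/andP[]] := tE n.
have ul : (j \o a) n @[n --> \oo] --> j (g l).
  have -> : j \o a = (j \o g) \o t.
    by apply/funext => n /=; rewrite (tE n).2.
  have cjg : {for l, continuous (j \o g)}.
    by apply: continuous_comp; [exact: cg|exact: cj].
  exact: cvg_comp tl cjg.
have ul' : j (a n.+1) @[n --> \oo] --> j (g l) by rewrite (cvg_shiftS (j \o a)).
have : j (a n.+1) - j (a n) @[n --> \oo] --> (0 : V).
  by rewrite -(subrr (j (g l))); exact: cvgB.
move=> /cvgr0Pnorm_lt/(_ e e0)[N _ NP].
by exists N; apply: NP => /=.
Qed.

(** A long line does not inject continuously into a normed space, because a continuous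
    map from it to a metric space is eventually constant. Concretely, suppose that
    every sequence of the component is bounded above in it. By bounded_small_step no
    sequence can make infinitely many steps of length more than d, so for each d > 0
    some tail of the component stays within d of its starting point. A bound b of
    starting points for d = 1, 1/2, 1/3, ... then has a tail of diameter 0,
    that is, b is a maximum. *)
Lemma countable_cofinal x0 :
  (forall x, joined x0 x -> exists2 y, joined x0 y & lt x y) ->
  exists e : nat -> T, (forall n, joined x0 (e n)) /\
    forall x, joined x0 x -> exists n, le x (e n).
Proof.
move=> nomax; apply: contrapT => nocof.
have bnd (e : nat -> T) : (forall n, joined x0 (e n)) ->
    exists2 b, joined x0 b & forall n, le (e n) b.
  move=> eC; apply: contrapT => nb; apply: nocof; exists e; split=> // x x0x.
  apply: contrapT => /forallNP ne; apply: nb; exists x => // n.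
  by have [/ne|[]] := lin_leP lin x (e n).
have tail (d : R) : 0 < d -> exists x, joined x0 x /\
    forall y, joined x0 y -> le x y -> `|j y - j x| <= d.
  move=> d0; apply: contrapT => /forallNP far.
  have step x : exists y, joined x0 x ->
      [/\ joined x0 y, le x y & d < `|j y - j x|].
    have [x0x|] := pselect (joined x0 x); last by exists x.
    apply: contrapT => /forallNP ny; apply: (far x); split=> // y x0y xy.
    by rewrite leNgt; apply/negP => dxy; apply: (ny y).
  have [F FP] := choice step; pose a n := iter n F x0.
  have aC n : joined x0 (a n).
    by elim: n => [|n /FP[]//]; exact: joined_refl.
  have [b x0b ab] := bnd a aC.
  have ai n : le (a n) (a n.+1) by have [] := FP _ (aC n).
  have [n] := bounded_small_step ai ab x0b d0.
  by have [_ _ dn] := FP _ (aC n); rewrite ltNge (ltW dn).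
have [x xP] := choice (fun n : nat => tail n.+1%:R^-1 ltac:(by rewrite invr_gt0)).
have [b x0b xb] := bnd x (fun n => (xP n).1).
have [c x0c bc] := nomax b x0b.
case: (bc) => _; apply; apply: ij; apply/eqP; rewrite -subr_eq0 -normr_le0.
apply/ler_addgt0Pl => e e0; rewrite addr0.
have [n ne] : exists n : nat, n.+1%:R^-1 < e / 2.
  have := near_infty_natSinv_lt (PosNum (divr_gt0 e0 (@ltr0Sn R 1))).
  by move=> [N _ /(_ N (leqnn N))] /= H; exists N.
have db := (xP n).2 b x0b (xb n).
have dc := (xP n).2 c x0c (lin_trans lin (xb n) bc.1).
rewrite (le_trans (ler_distD (j (x n)) _ _))// (distrC (j (x n))).
by rewrite [leRHS](splitr e) lerD// (le_trans _ (ltW ne)).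
Qed.

End cofinality.

(** * Real parameters for arc components *)

Section charts.
Context {R : realType} {T : topologicalType}.
Context {le : T -> T -> Prop} (lin : linear_order le).
Local Notation lt := (strict le).
Implicit Types (C : set T) (x y w : T).

Definition cofinal_sequence C (e : nat -> T) : Prop :=
  (forall n, C (e n)) /\ forall x, C x -> exists n, le x (e n).

Lemma strictly_cofinal C b e : C b -> cofinal_sequence C e ->
  (forall x, C x -> exists2 y, C y & lt x y) ->
  exists c : nat -> T, [/\ c 0%N = b, forall n, C (c n),
    forall n, lt (c n) (c n.+1) & forall x, C x -> exists n, lt x (c n)].
Proof.
move=> Cb [eC ecof] nomax.
have step (p : nat * T) : exists y, C p.2 ->
    [/\ C y, lt p.2 y & lt (e p.1) y].
  have [Cp|] := pselect (C p.2); last by exists b.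
  have [ep|pe] := lin_total lin (e p.1) p.2.
    have [y Cy py] := nomax _ Cp; exists y => _; split=> //.
    exact: (lin_le_lt_trans lin ep).
  have [y Cy ey] := nomax _ (eC p.1); exists y => _; split=> //.
  exact: (lin_le_lt_trans lin pe).
have [F FP] := choice step.
pose c := fix c n := if n is m.+1 then F (m, c m) else b.
have cC n : C (c n) by elim: n => //= n IH; have [] := FP (n, c n) IH.
exists c; split=> //; first by move=> n; have [] := FP (n, c n) (cC n).
move=> x /ecof[n xn]; exists n.+1; apply: (lin_le_lt_trans lin xn).
by have [] := FP (n, c n) (cC n).
Qed.

(** Along a strictly increasing cofinal sequence c of first term b, the points above
    b are cut into the intervals [c n, c n.+1], which are arcs; the n-th one is
    parametrized by [n, n + 1]. *)
Lemma ray_chart_unbounded C b e : C b -> cofinal_sequence C e ->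
  (forall x, C x -> exists2 y, C y & lt x y) ->
  (forall x y, C x -> C y -> lt x y ->
     exists g : R -> T, segment_chart le x y g) ->
  (forall x y w, C x -> C y -> le x w -> le w y -> C w) ->
  exists g : R -> T, increasing_on le `[0, +oo[ g /\
    g @` `[0, +oo[ = [set x | C x /\ le b x].
Proof.
move=> Cb ecof nomax chart convC.
have [c [c0 cC cS cc]] := strictly_cofinal Cb ecof nomax.
have cle m n : (m <= n)%N -> le (c m) (c n).
  elim: n => [|n IH]; first by rewrite leqn0 => /eqP->; exact: (lin_refl lin _).
  rewrite leq_eqVlt => /orP[/eqP->|/IH mn]; first exact: (lin_refl lin _).
  exact: (lin_trans lin mn (cS n).1).
have [G GP] := choice (fun n => chart _ _ (cC n) (cC n.+1) (cS n)).
pose g (r : R) := G (Num.truncn r) (r - (Num.truncn r)%:R).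
have gE n t : 0 <= t < 1 -> g (n%:R + t) = G n t.
  move=> /andP[t0 t1]; rewrite /g; suff -> : Num.truncn (n%:R + t) = n.
    by rewrite addrC addKr.
  by apply/truncn_def; rewrite lerDl t0 -natr1 ltrD2l.
have gI r : 0 <= r -> exists n t, [/\ r = n%:R + t, 0 <= t < 1,
    le (c n) (g r) & lt (g r) (c n.+1)].
  move=> r0; have /andP[rn rn1] := truncn_itv r0.
  exists (Num.truncn r), (r - (Num.truncn r)%:R).
  set n := Num.truncn r; set t := r - n%:R.
  have rE : r = n%:R + t by rewrite /t addrC subrK.
  have t01 : 0 <= t < 1.
    by rewrite /t subr_ge0 rn/= ltrBlDl natr1.
  rewrite {2 3}rE gE//; have [_ inc G0 G1 _] := GP n.
  case/andP: t01 => t0 t1; split=> //; [by rewrite t0| |]; last first.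
    by rewrite -G1; apply: inc; rewrite //= in_itv/= ?lexx ?ler01 ?t0 ?(ltW t1).
  have [<-|tn0] := eqVneq 0 t; first by rewrite G0; exact: (lin_refl lin _).
  rewrite -G0; apply: (inc _ _ _ _ _).1;
    rewrite /= ?in_itv/= ?lexx ?ler01 ?t0 ?(ltW t1)//.
  by rewrite lt_neqAle tn0.
exists g; split.
  move=> r s; rewrite /= !in_itv/= !andbT => r0 s0 rs.
  have [n [t [rE t01 cr rc]]] := gI r r0; have [m [u [sE u01 cs sc]]] := gI s s0.
  have [nm|mn|nm] := ltngtP n m.
  - exact: (lin_lt_le_trans lin rc (lin_trans lin (cle _ _ nm) cs)).
  - case/andP: t01 u01 rs => t0 t1 /andP[u0 u1]; rewrite rE sE.
    have mn1 : m%:R + 1 <= n%:R :> R by rewrite natr1 ler_nat.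
    by rewrite ltNge => /negP; case; lra.
  - move: rs; rewrite rE sE nm ltrD2l => tu; rewrite !gE//.
    have [_ inc _ _ _] := GP m; case/andP: t01 u01 => t0 t1 /andP[u0 u1].
    by apply: inc; rewrite //= in_itv/= ?t0 ?u0 ltW.
rewrite predeqE => x; split.
  move=> [r]; rewrite /= in_itv/= andbT => /gI[n [t [_ _ cr rc]]] <-.
  split; first exact: (convC _ _ _ (cC n) (cC n.+1) cr rc.1).
  by rewrite -c0; exact: (lin_trans lin (cle _ _ (leq0n n)) cr).
move=> [Cx bx].
have [n xn nmin] : exists2 n, lt x (c n.+1) & le (c n) x.
  have [m] := cc x Cx; elim: m => [|m IH] xm.
    by exfalso; apply: (lin_lt_le lin xm); rewrite c0.
  by have [?|/IH//] := lin_leP lin (c m) x; exists m.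
have [_ inc _ G1 onto] := GP n; have [t /andP[t0 t1] tx] := onto _ nmin xn.1.
have {}t1 : t < 1.
  rewrite lt_neqAle t1 andbT; apply/eqP => tE.
  by apply: xn.2; rewrite -tx tE G1.
exists (n%:R + t); first by rewrite /= in_itv/= andbT addr_ge0.
by rewrite gE ?t0.
Qed.

(** The map s |-> s / (1 - s) is an increasing bijection from [0, 1[ to [0, +oo[. *)
Lemma ray_chart C b e : C b -> cofinal_sequence C e ->
  (forall x, C x -> exists2 y, C y & lt x y) ->
  (forall x y, C x -> C y -> lt x y ->
     exists g : R -> T, segment_chart le x y g) ->
  (forall x y w, C x -> C y -> le x w -> le w y -> C w) ->
  exists g : R -> T, increasing_on le `[0, 1[ g /\
    g @` `[0, 1[ = [set x | C x /\ le b x].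
Proof.
move=> Cb ecof nomax chart convC.
have [g [gI gE]] := ray_chart_unbounded Cb ecof nomax chart convC.
exists (fun s => g (s / (1 - s))); split.
  move=> s t; rewrite /= !in_itv/= => /andP[s0 s1] /andP[t0 t1] st.
  have s1' : 0 < 1 - s by rewrite subr_gt0.
  have t1' : 0 < 1 - t by rewrite subr_gt0.
  apply: gI; rewrite /= ?in_itv/= ?andbT ?divr_ge0 ?(ltW s1') ?(ltW t1')//.
  by rewrite ltr_pdivrMr// mulrAC ltr_pdivlMr//; nra.
rewrite -gE predeqE => x; split=> -[s]; rewrite /= in_itv/=.
  move=> /andP[s0 s1] <-; exists (s / (1 - s)) => //.
  by rewrite /= in_itv/= andbT divr_ge0// subr_ge0 ltW.
rewrite andbT => s0 <-; have s1 : 0 < 1 + s by rewrite ltr_wpDr.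
exists (s / (1 + s)).
  by rewrite /= in_itv/= divr_ge0 ?(ltW s1)//= ltr_pdivrMr// mul1r ltrDr ltr01.
by congr g; field; rewrite (gt_eqF s1)/=; apply/eqP; lra.
Qed.

End charts.

Section component_charts.
Context {R : realType} {T : topologicalType} (hT : hausdorff_space T).
Context {le : T -> T -> Prop} (lin : linear_order le) (conv : arc_convex le).
Context {V : normedModType R} (j : T -> V).
Hypotheses (cj : continuous j) (ij : injective j).
Local Notation lt := (strict le).
Local Notation joined := (arc_component R).

(** The cofinal sequence that a ray needs exists because the space embeds in a normed
    space; the other requirements come from the convexity of arcs. *)
Lemma component_ray x0 b : joined x0 b ->
  (forall x, joined x0 x -> exists2 y, joined x0 y & lt x y) ->
  exists g : R -> T, increasing_on le `[0, 1[ g /\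
    g @` `[0, 1[ = [set x | joined x0 x /\ le b x].
Proof.
move=> x0b nomax; have [e ecof] := countable_cofinal hT lin conv cj ij nomax.
have joinx0 x y : joined x0 x -> joined x0 y -> joined x y.
  by move=> x0x; apply: (joined_trans hT lin conv); exact: joined_sym.
apply: (ray_chart lin x0b ecof nomax) => [x y x0x x0y xy|x y w x0x x0y xw wy].
  by apply/(joined_chartP hT lin conv xy); exact: joinx0.
apply: (joined_trans hT lin conv x0x).
by have [] := joined_convex hT lin conv (joinx0 _ _ x0x x0y) xw wy.
Qed.

End component_charts.

Section component_lines.
Context {R : realType} {T : topologicalType} (hT : hausdorff_space T).
Context {le : T -> T -> Prop} (lin : linear_order le) (conv : arc_convex le).
Context {V : normedModType R} (j : T -> V).
Hypotheses (cj : continuous j) (ij : injective j).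
Local Notation lt := (strict le).
Local Notation joined := (arc_component R).

(** The points above x0 and, after reversing the order, those below x0 form rays;
    they are put end to end at the parameter 1/2. *)
Lemma component_line x0 :
  (forall x, joined x0 x -> exists2 y, joined x0 y & lt x y) ->
  (forall x, joined x0 x -> exists2 y, joined x0 y & lt y x) ->
  exists g : R -> T, increasing_on le `]0, 1[ g /\
    g @` `]0, 1[ = joined x0.
Proof.
move=> nomax nomin; have x0x0 : joined x0 x0 by exact: joined_refl.
have [gu [iu gu_onto]] := component_ray hT lin conv cj ij x0x0 nomax.
have nomax' x : joined x0 x ->
    exists2 y, joined x0 y & strict (fun a b => le b a) x y.
  by move=> /nomin[y x0y [yx nyx]]; exists y => //; split=> // /esym.
have [gd [id_ gd_onto]] := component_ray hT (linear_order_flip lin)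
  (arc_convex_flip conv) cj ij x0x0 nomax'.
have up s : 0 <= s -> s < 1 -> joined x0 (gu s) /\ le x0 (gu s).
  move=> s0 s1; have : (gu @` `[0, 1[) (gu s) by exists s; rewrite //= in_itv/= s0.
  by rewrite gu_onto.
have down s : 0 <= s -> s < 1 -> joined x0 (gd s) /\ le (gd s) x0.
  move=> s0 s1; have : (gd @` `[0, 1[) (gd s) by exists s; rewrite //= in_itv/= s0.
  by rewrite gd_onto.
have gd0 : gd 0 = x0.
  have : (gd @` `[0, 1[) x0 by rewrite gd_onto; split=> //; exact: (lin_refl lin).
  move=> [s]; rewrite /= in_itv/= => /andP[s0 s1] sx0.
  have [->//|sn0] := eqVneq 0 s; have s0' : 0 < s by rewrite lt_neqAle sn0.
  have := id_ 0 s; rewrite /= !in_itv/= lexx ltr01 s0 s1 => /(_ isT isT s0').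
  rewrite sx0 => -[h1 h2]; exfalso; apply: h2.
  by apply: (lin_anti lin); [exact: (down 0 (lexx _) ltr01).2|exact: h1].
exists (fun s => if s < 1 / 2 then gd (1 - 2 * s) else gu (2 * s - 1)); split.
  move=> s t; rewrite /= !in_itv/= => /andP[s0 s1] /andP[t0 t1] st.
  have [sl|sl] := ltP s (1 / 2); have [tl|tl] := ltP t (1 / 2).
  - have [] := id_ (1 - 2 * t) (1 - 2 * s); rewrite /= ?in_itv/=.
    + by apply/andP; split; lra.
    + by apply/andP; split; lra.
    + by lra.
    + by move=> h1 h2; split=> // /esym.
  - apply: (lin_lt_le_trans lin (y := x0)).
      have [] := id_ 0 (1 - 2 * s); rewrite /= ?in_itv/= ?lexx ?ltr01//.
      + by apply/andP; split; lra.
      + by lra.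
      + by rewrite gd0 => h1 h2; split=> // /esym.
    by apply: (up _ _ _).2; lra.
  - by exfalso; move: st; rewrite ltNge (le_trans (ltW tl) sl).
  - by apply: iu; rewrite /= ?in_itv/=; [apply/andP; split|apply/andP; split|]; lra.
rewrite predeqE => x; split.
  move=> [s]; rewrite /= in_itv/= => /andP[s0 s1] <-; have [sl|sl] := ltP s (1 / 2).
    by apply: (down _ _ _).1; lra.
  by apply: (up _ _ _).1; lra.
move=> x0x; have [x0lx|xlx0] := lin_leP lin x0 x.
  have : (gu @` `[0, 1[) x by rewrite gu_onto.
  move=> [s]; rewrite /= in_itv/= => /andP[s0 s1] <-; exists ((1 + s) / 2).
    by rewrite /= in_itv/=; apply/andP; split; lra.
  by rewrite ltNge ifF; [congr gu; lra|apply/negbF; lra].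
have : (gd @` `[0, 1[) x by rewrite gd_onto; split=> //; exact: xlx0.1.
move=> [s]; rewrite /= in_itv/= => /andP[s0 s1] sx.
have sn0 : s != 0 by apply: contra_notN xlx0.2 => /eqP s00; rewrite -sx s00 gd0.
have {sn0}s0 : 0 < s by rewrite lt_neqAle eq_sym sn0.
exists ((1 - s) / 2); first by rewrite /= in_itv/=; apply/andP; split; lra.
by rewrite ifT; [rewrite -sx; congr gd; lra|lra].
Qed.

End component_lines.

(** * Order topologies that split into intervals *)

Section order_space_theory.
Context {T : choiceType} {le : T -> T -> Prop}.
Local Notation lt := (strict le).

Lemma open_rays_open A : open_rays le A -> open (A : set (order_space le)).
Proof.
move=> rA; exists [set A]; last by rewrite bigcup_set1.
move=> _ ->; exists [fset A]%fset; last first.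
  rewrite predeqE => x; split => [|Ax B /fset1P ->//].
  by apply; exact: fset11.
by move=> B /fset1P ->; exact: mem_set.
Qed.

Lemma open_ray_below a : open ([set x | lt x a] : set (order_space le)).
Proof. by apply: open_rays_open; exists a; left. Qed.

Lemma open_ray_above a : open ([set x | lt a x] : set (order_space le)).
Proof.
apply: open_rays_open; exists a; right; rewrite predeqE => x.
by split=> -[ax nax]; split=> // /esym.
Qed.

Lemma continuous_order_space (S : topologicalType) (f : S -> order_space le) :
  (forall a, open (f @^-1` [set x | lt x a])) ->
  (forall a, open (f @^-1` [set x | lt a x])) -> continuous f.
Proof.
move=> fb fa; apply/continuousP => _ [D DS <-].
rewrite preimage_bigcup; apply: bigcup_open => B /DS [F FS <-].
rewrite preimage_bigcap bigcap_fset big_seq.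
apply: (big_ind open) => [|A C|A /FS]; [exact: openT|exact: openI|].
move=> /set_mem[a [->|->]]; first exact: fb.
move: (fa a); congr open; rewrite predeqE => x.
by split=> -[ax nax]; split=> // /esym.
Qed.

End order_space_theory.

Lemma open_all_or_none (S : topologicalType) (A : set S) :
  (forall r s, A r -> A s) -> open A.
Proof.
move=> AA; have [[r Ar]|none] := pselect (exists r, A r).
  by rewrite (_ : A = setT) ?predeqE; [exact: openT|split=> // _; exact: AA Ar].
by rewrite (_ : A = set0) ?predeqE; [exact: open0|split=> // Ar; apply: none; exists x].
Qed.

Section sum_of_intervals.
Context {R : realType} {T : choiceType}.
Context {le : T -> T -> Prop} (lin : linear_order le).
Context {I : choiceType} (comp : T -> I) (J : I -> set R) (chart : I -> R -> T).
Local Notation lt := (strict le).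
Hypothesis comp_convex : forall x y w,
  comp x = comp y -> le x w -> le w y -> comp w = comp x.
Hypothesis J_itv : forall i, is_interval (J i).
Hypothesis chart_incr : forall i, increasing_on le (J i) (chart i).
Hypothesis chart_comp : forall i r, J i r -> comp (chart i r) = i.
Hypothesis chart_onto : forall x, exists2 r, J (comp x) r & chart (comp x) r = x.
Hypothesis J_nomax : forall i r, J i r -> exists2 s, J i s & r < s.
Hypothesis J_nomin : forall i r, J i r ->
  (forall y, le (chart i r) y) \/ exists2 s, J i s & s < r.

Let X := {i & set_type (J i)}.
Let glue (p : X) : order_space le := chart (tag p) (val (tagged p)).

Let J_between i r s t : J i r -> J i t -> r <= s -> s <= t -> J i s.
Proof. by move=> Jr Jt rs st; apply: (J_itv Jr Jt); rewrite rs. Qed.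

Let glue_comp p : comp (glue p) = tag p.
Proof. by apply: chart_comp; exact: set_valP. Qed.

Let glue_inj : injective glue.
Proof.
move=> p q pq; have tpq : tag p = tag q by rewrite -!glue_comp pq.
case: p q tpq pq => i r [k s] /= ik; case: k / ik s => s.
rewrite /glue/= => /(increasing_on_inj (chart_incr (i := i))) rs.
by congr existT; apply/val_inj/rs; exact: set_valP.
Qed.

Let unglue_ex x : exists p, glue p = x.
Proof.
have [r Jr rx] := chart_onto x.
by exists (existT (fun i => set_type (J i)) (comp x) (in_set Jr)).
Qed.

Let open_below_val i (c : R) : open [set r : set_type (J i) | val r < c].
Proof.
by exists [set r | r < c]; [exact: open_lt|].
Qed.

Let open_above_val i (c : R) : open [set r : set_type (J i) | c < val r].
Proof.
by exists [set r | c < r]; [exact: open_gt|].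
Qed.

Let incr_iff i s t : J i s -> J i t -> lt (chart i s) (chart i t) <-> s < t.
Proof.
by move=> Js Jt; split; [exact: increasing_on_lt|exact: chart_incr].
Qed.

Let outside i a r s : comp a <> i -> J i r -> J i s ->
  lt (chart i r) a -> lt (chart i s) a.
Proof.
move=> nai Jr Js ra; have [as_|//] := lin_leP lin a (chart i s); case: nai.
by rewrite (comp_convex _ ra.1 as_) !chart_comp.
Qed.

(** A ray whose end is on another component contains either all of the i-th
    component or nothing of it, and a ray whose end is on the i-th component is
    the image of a ray of real numbers. *)
Lemma continuous_chart i :
  continuous (fun r : set_type (J i) => chart i (val r) : order_space le).
Proof.
apply: continuous_order_space => a; have [ai|nai] := pselect (comp a = i).
- have [s] := chart_onto a; rewrite ai => Js <-.
  move: (open_below_val i s); congr open; rewrite predeqE => r /=.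
  by apply: iff_sym; apply: incr_iff => //; exact: set_valP.
- apply: open_all_or_none => r s.
  exact: (outside nai (set_valP r) (set_valP s)).
- have [s] := chart_onto a; rewrite ai => Js <-.
  move: (open_above_val i s); congr open; rewrite predeqE => r /=.
  by apply: iff_sym; apply: incr_iff => //; exact: set_valP.
- apply: open_all_or_none => r s /= ar.
  have [sa|//] := lin_leP lin (chart i (val s)) a; exfalso.
  have sa' : lt (chart i (val s)) a.
    by split=> // saE; apply: nai; rewrite -saE chart_comp//; exact: set_valP.
  apply: (lin_lt_le lin ar).
  exact: (outside nai (set_valP s) (set_valP r) sa').1.
Qed.

Lemma continuous_glue_charts : continuous glue.
Proof. by move=> [i r] V nV; exact: continuous_chart nV. Qed.

Let nbhs_chart i (r : set_type (J i)) (B : set (set_type (J i))) :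
  nbhs r B -> exists2 e : R, 0 < e &
    forall s (Js : J i s), val r - e < s < val r + e -> B (in_set Js).
Proof.
move=> [_ [[W oW <-] /= Wr] WB].
have /nbhs_ballP[e /= e0 eW] := open_nbhs_nbhs (conj oW Wr).
exists e => // s Js rs; apply: WB => /=; apply: eW => /=.
by rewrite /ball/= ltr_distlC.
Qed.

(** A linearly ordered set that is cut into convex pieces, each of them a copy of an
    interval of real numbers without maximum, and without minimum except that of the
    whole set, is the topological sum of these intervals. Indeed each point of a piece
    is strictly between two points of the same piece (or is the minimum of the whole
    set), so pieces are open. The homeomorphism is the inverse of the map that glues
    the charts, which spares transporting elements of J along equalities of indices. *)
Lemma sum_of_intervals_homeo : exists h : order_space le -> X,
  homeomorphism h /\ forall x, tag (h x) = comp x.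
Proof.
have [h hK] := choice unglue_ex.
have Kh : cancel glue h by move=> p; apply: glue_inj; rewrite hK.
exists h; split; last by move=> x; rewrite -glue_comp hK.
exists glue; split=> //; last exact: continuous_glue_charts.
move=> x V nV; case hx : (h x) => [i r].
have xE : chart i (val r) = x by rewrite -[x]hK hx.
move: nV; rewrite hx => /nbhs_chart[e e0 eV].
have Jr : J i (val r) by exact: set_valP.
(* A ray A around x bounded below by a point of the i-th piece whose parameter
     exceeds r - e, or the whole space when x is the minimum; then a ray B for the
     upper side. Convexity keeps A and B together inside the i-th piece. *)
have [A [oA Ax [s0 [Js0 s0r As0]]]] : exists A : set (order_space le),
    [/\ open A, A x & exists s0, [/\ J i s0, val r - e < s0 &
      forall y, A y -> le (chart i s0) y]].
  have [xmin|[s Js sr]] := J_nomin Jr.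
    exists setT; split=> //; first exact: openT.
    by exists (val r); split=> //; rewrite ltrBlDr ltrDl.
  pose s0 := Num.max s (val r - e / 2).
  have s0r : s0 < val r by rewrite gt_max sr ltrBlDr ltrDl divr_gt0.
  have Js0 : J i s0 by apply: (J_between Js Jr); [rewrite le_max lexx|exact: ltW].
  exists [set y | lt (chart i s0) y]; split; first exact: open_ray_above.
    by rewrite /= -xE; apply/incr_iff.
  exists s0; split=> // [|y []//].
  by rewrite lt_max; apply/orP; right; lra.
have [B [oB Bx [s1 [Js1 s1r Bs1]]]] : exists B : set (order_space le),
    [/\ open B, B x & exists s1, [/\ J i s1, s1 < val r + e &
      forall y, B y -> le y (chart i s1)]].
  have [s Js rs] := J_nomax Jr.
  pose s1 := Num.min s (val r + e / 2).
  have s1r : val r < s1 by rewrite lt_min rs ltrDl divr_gt0.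
  have Js1 : J i s1 by apply: (J_between Jr Js); [exact: ltW|rewrite ge_min lexx].
  exists [set y | lt y (chart i s1)]; split; first exact: open_ray_below.
    by rewrite /= -xE; apply/incr_iff.
  exists s1; split=> // [|y []//].
  by rewrite gt_min; apply/orP; right; lra.
have : nbhs x (A `&` B) by apply: open_nbhs_nbhs; split=> //; exact: openI.
apply: filterS => y [/As0 s0y /Bs1 ys1] /=.
have yi : comp y = i.
  by rewrite (comp_convex _ s0y ys1) !chart_comp.
have [s] := chart_onto y; rewrite yi => Js sy.
have -> : h y = existT (fun i => set_type (J i)) i (in_set Js).
  by apply: glue_inj; rewrite hK -sy.
apply: eV; apply/andP; split.
  apply: lt_le_trans s0r _; rewrite leNgt; apply/negP => /(chart_incr Js Js0).
  by rewrite sy => /(lin_lt_le lin); apply.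
apply: le_lt_trans s1r; rewrite leNgt; apply/negP => /(chart_incr Js1 Js).
by rewrite sy => /(lin_lt_le lin); apply.
Qed.

End sum_of_intervals.

(** * The Cantor set *)

Section cantor.
Context {R : realType}.
Implicit Types (c y : R).
Local Notation cantor := (@cantor_ternary R).

Lemma cantor_step_itv n c : cantor_step n c -> 0 <= c <= 1.
Proof.
elim: n c => [|n IH] c; first by rewrite /= in_itv.
by move=> [] [y /IH/andP[y0 y1] <-]; apply/andP; split; lra.
Qed.

Lemma cantor_itv c : cantor c -> 0 <= c <= 1.
Proof. by move=> /(_ 0%N I)/cantor_step_itv. Qed.

Lemma cantor_left c : cantor c -> cantor (c / 3).
Proof.
move=> cc [|n] _; last by left; exists c => //; exact: cc.
by rewrite /= in_itv/=; case/andP: (cantor_itv cc) => *; apply/andP; split; lra.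
Qed.

Lemma cantor_right c : cantor c -> cantor ((c + 2) / 3).
Proof.
move=> cc [|n] _; last by right; exists c => //; exact: cc.
by rewrite /= in_itv/=; case/andP: (cantor_itv cc) => *; apply/andP; split; lra.
Qed.

(** Self-similarity: c is y / 3 or (y + 2) / 3 for some y of the Cantor set. *)
Lemma cantor_third c : cantor c ->
  (c <= 1 / 3 /\ cantor (3 * c)) \/ (2 / 3 <= c /\ cantor (3 * c - 2)).
Proof.
move=> cc; have [] := cc 1%N I => -[y]; rewrite /= in_itv/= => /andP[y0 y1] yc.
  left; split=> [|n _]; first by lra.
  have [] := cc n.+1 I => -[z nz zc]; first by rewrite (_ : 3 * c = z)//; lra.
  by have /andP[z0 z1] := cantor_step_itv nz; exfalso; lra.
right; split=> [|n _]; first by lra.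
have [] := cc n.+1 I => -[z nz zc]; last by rewrite (_ : 3 * c - 2 = z)//; lra.
by have /andP[z0 z1] := cantor_step_itv nz; exfalso; lra.
Qed.

Lemma cantor_sym c : cantor c -> cantor (1 - c).
Proof.
move=> cc n _; have := cc n I; elim: n c {cc} => [|n IH] c /=.
  by rewrite !in_itv/= => /andP[c0 c1]; apply/andP; split; lra.
move=> [] [y /IH ny <-]; [right|left]; exists (1 - y) => //; lra.
Qed.

Lemma cantor_nhalf : ~ cantor (1 / 2).
Proof. by move=> /cantor_third[] []; lra. Qed.

(** The part of the Cantor set in the block [2 / 3^(n+1), 1 / 3^n], on which the lower
    semicircles of index n + 1 rest, is a copy of the whole set. *)
Lemma cantor_block n c : cantor c -> 2 / 3 ^+ n.+1 <= c <= 1 / 3 ^+ n ->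
  exists2 y, cantor y & c = (y + 2) / 3 ^+ n.+1.
Proof.
elim: n c => [|n IH] c cc.
  rewrite expr1 expr0 => /andP[c0 c1].
  have [[c2 _]|[_ cc']] := cantor_third cc; first by exfalso; lra.
  by exists (3 * c - 2) => //; lra.
have e3 : 0 < 3 ^+ n :> R by rewrite exprn_gt0.
rewrite !exprS => /andP[lo hi].
have [[c2 cc']|[c2 _]] := cantor_third cc; last first.
  suff : 1 / (3 * 3 ^+ n) < 2 / 3 :> R by move=> ?; exfalso; lra.
  have : 1 <= 3 ^+ n :> R by rewrite exprn_ege1// ler1n.
  by move=> e1; rewrite ltr_pdivrMr ?mulr_gt0//; lra.
have [|y cy ey] := IH _ cc'.
  rewrite exprS; apply/andP; split.
    rewrite (_ : 2 / _ = 3 * (2 / (3 * (3 * 3 ^+ n)))); first by lra.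
    by field; rewrite gt_eqF.
  rewrite (_ : 1 / 3 ^+ n = 3 * (1 / (3 * 3 ^+ n))); first by lra.
  by field; rewrite gt_eqF.
exists y => //; rewrite exprS in ey.
suff : 3 * c = 3 * ((y + 2) / (3 * (3 * 3 ^+ n))) by lra.
by rewrite ey; field; rewrite gt_eqF.
Qed.

Lemma cantor_blockI n y : cantor y ->
  cantor ((y + 2) / 3 ^+ n.+1) /\
  2 / 3 ^+ n.+1 <= (y + 2) / 3 ^+ n.+1 <= 1 / 3 ^+ n.
Proof.
move=> cy; have /andP[y0 y1] := cantor_itv cy.
have e3 k : 0 < 3 ^+ k :> R by rewrite exprn_gt0.
split.
  elim: n => [|n IH]; first by rewrite expr1; exact: cantor_right.
  rewrite exprS (_ : _ / _ = ((y + 2) / 3 ^+ n.+1) / 3); first exact: cantor_left.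
  by field; rewrite gt_eqF.
apply/andP; split; first by rewrite ler_pM2r ?invr_gt0//; lra.
rewrite ler_pdivrMr// exprS (_ : 1 / _ * _ = 3); first by lra.
by field; rewrite gt_eqF.
Qed.

(** Each positive point of the Cantor set is in some block, so that a lower semicircle
    starts from it. The block is found by tripling c until it exceeds 1/3. *)
Lemma cantor_pos_block c : cantor c -> 0 < c ->
  exists n, exists2 y, cantor y & c = (y + 2) / 3 ^+ n.+1.
Proof.
move=> cc c0; have [k kc] : exists k, 1 < 3 ^+ k * c.
  exists (Num.bound c^-1).
  have := archi_boundP (ltW (_ : 0 < c^-1)); rewrite invr_gt0 => /(_ c0) cb.
  rewrite -ltr_pdivrMr// div1r (lt_le_trans cb)//.
  by rewrite -natrX ler_nat ltnW// ltn_expl.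
elim: k c cc c0 kc => [|k IH] c cc c0 kc.
  by have /andP[_ c1] := cantor_itv cc; exfalso; move: kc; rewrite expr0; lra.
have [[_ cc']|[_ cc']] := cantor_third cc; last first.
  by exists 0%N, (3 * c - 2) => //; rewrite expr1; lra.
have [||n [y cy ey]] := IH _ cc'; first by rewrite mulr_gt0.
  by rewrite mulrA -exprSr.
exists n.+1, y => //; have e3 : 0 < 3 ^+ n.+1 :> R by rewrite exprn_gt0.
rewrite exprS; suff : 3 * c = 3 * ((y + 2) / (3 * 3 ^+ n.+1)) by lra.
by rewrite ey; field; rewrite gt_eqF.
Qed.

(** The reflection that a lower semicircle induces between its end points becomes
    y |-> 1 - y on the block. *)
Lemma block_sym n y :
  5 / 3 ^+ n.+1 - (y + 2) / 3 ^+ n.+1 = ((1 - y) + 2) / 3 ^+ n.+1 :> R.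
Proof. by rewrite -mulrBl; congr (_ / _); lra. Qed.

(** No point of a block is its centre, since 1/2 is not in the Cantor set; this is why
    no semicircle of the Knaster continuum is reduced to a point. *)
Lemma block_center n y : cantor y -> (y + 2) / 3 ^+ n.+1 <> 5 / (2 * 3 ^+ n.+1).
Proof.
move=> cy /eqP; have e3 : 3 ^+ n.+1 != 0 :> R by rewrite expf_neq0.
rewrite invfM mulrA => /eqP/(mulIf (invr_neq0 e3)) yE.
by apply: cantor_nhalf; rewrite (_ : 1 / 2 = y)//; lra.
Qed.

End cantor.

(** * Semicircles in the Knaster continuum *)

Section semicircles.
Context {R : realType}.
Implicit Types (m c r s u : R) (p q : knaster R).

Lemma knaster_hausdorff : hausdorff_space (knaster R).
Proof.
have hRR : hausdorff_space (R * R)%type by exact: norm_hausdorff.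
move=> p q pq; apply/val_inj/hRR => A B pA qB.
have [z [Az Bz]] := pq _ _ (@continuous_val _ _ p A pA) (@continuous_val _ _ q B qB).
by exists (val z).
Qed.

Lemma same_circleE m c (p : R * R) :
  same_circle m c p <-> (p.1 - m) ^+ 2 + p.2 ^+ 2 = (c - m) ^+ 2.
Proof.
rewrite /same_circle /Defs.edist /= !subr0 expr0n addr0; split=> [|->//].
by move=> /eqP; rewrite eqr_sqrt ?addr_ge0 ?sqr_ge0// => /eqP.
Qed.

(** The semicircle of centre (m, 0) and radius r, in the upper (s = 1) or lower
    (s = -1) half plane, parametrized by the abscissa, which makes injectivity obvious. *)
Definition semicircle m r s u : R * R :=
  let x := clamp (m - r) (m + r) u in (x, s * Num.sqrt (r ^+ 2 - (x - m) ^+ 2)).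

Lemma semicircle_continuous m r s : continuous (semicircle m r s).
Proof.
have cx := @clamp_continuous R (m - r) (m + r).
have cd : continuous (fun u => clamp (m - r) (m + r) u - m).
  by move=> u; apply: continuousB; [exact: cx|exact: cst_continuous].
pose h u := Num.sqrt (r ^+ 2 - (clamp (m - r) (m + r) u - m) ^+ 2).
have ch : continuous h.
  move=> u; apply: continuous_comp; last exact: sqrt_continuous.
  apply: continuousB; first exact: cst_continuous.
  exact: (continuous_comp (cd u) (@exprn_continuous _ 2 _)).
have cy : continuous (fun u => s * h u).
  by move=> u; apply: (@continuousM _ _ (cst s) h); [exact: cst_continuous|exact: ch].
by move=> u; exact: (cvg_pair (cx u) (cy u)).
Qed.

Lemma semicircle_eq m r s u : 0 <= r -> s ^+ 2 = 1 ->
  ((semicircle m r s u).1 - m) ^+ 2 + (semicircle m r s u).2 ^+ 2 = r ^+ 2.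
Proof.
move=> r0 s1; rewrite /semicircle/=; set x := clamp _ _ _.
have /andP[x1 x2] : m - r <= x <= m + r by apply: clamp_itv; lra.
rewrite exprMn s1 mul1r sqr_sqrtr; first by rewrite addrC subrK.
by rewrite subr_ge0; nra.
Qed.

Lemma semicircle_on m r s (p : R * R) : s ^+ 2 = 1 -> 0 <= r -> 0 <= s * p.2 ->
  (p.1 - m) ^+ 2 + p.2 ^+ 2 = r ^+ 2 ->
  m - r <= p.1 <= m + r /\ semicircle m r s p.1 = p.
Proof.
move=> s1 r0 sp pE; case: p sp pE => x y /= sy xyE.
have xr : m - r <= x <= m + r.
  suff : `|x - m| <= r by rewrite ler_norml => /andP[? ?]; apply/andP; split; lra.
  rewrite -(ler_pXn2r (n := 2)) ?nnegrE//= real_normK ?num_real//.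
  by rewrite -xyE lerDl sqr_ge0.
split=> //; rewrite /semicircle clamp_id//; congr (_, _).
rewrite -xyE addrC addKr (_ : y ^+ 2 = (s * y) ^+ 2); last by rewrite exprMn s1 mul1r.
by rewrite sqrtr_sqr ger0_norm// mulrA -expr2 s1 mul1r.
Qed.

Definition carries m r s : Prop := forall u, knaster_set (semicircle m r s u).

Lemma upper_carries c : cantor_ternary c -> carries (1 / 2) `|c - 1 / 2| 1.
Proof.
move=> cc u; left; split.
  by rewrite /= mul1r sqrtr_ge0.
exists c => //; apply/same_circleE.
by rewrite semicircle_eq ?normr_ge0 ?expr1n// real_normK ?num_real.
Qed.

Lemma lower_carries n y : cantor_ternary y ->
  carries (5 / (2 * 3 ^+ n.+1))
    `|(y + 2) / 3 ^+ n.+1 - 5 / (2 * 3 ^+ n.+1)| (- 1).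
Proof.
move=> cy u; right; exists n.+1 => //; split.
  by rewrite /= mulN1r oppr_le0 sqrtr_ge0.
have [cc lh] := cantor_blockI n cy; exists ((y + 2) / 3 ^+ n.+1); split=> //.
apply/same_circleE.
by rewrite semicircle_eq ?normr_ge0 ?sqrrN ?expr1n// real_normK ?num_real.
Qed.

Section path.
Context m r s (H : carries m r s).

Definition semicircle_path u : knaster R := in_set (H u).

Lemma semicircle_path_continuous : continuous semicircle_path.
Proof. by apply: continuous_set_type; exact: semicircle_continuous. Qed.

Lemma semicircle_path_inj : inj_on (m - r) (m + r) semicircle_path.
Proof.
move=> u v uI vI /(congr1 val)/(congr1 fst)/=.
by rewrite !clamp_id.
Qed.

Lemma semicircle_path_arc u v : m - r <= u -> u < v -> v <= m + r ->
  is_arc R (semicircle_path @` `[u, v]).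
Proof.
move=> mu uv vm; apply: is_arc_path => //.
- exact: knaster_hausdorff.
- exact: semicircle_path_continuous.
- move=> a b /andP[ua av] /andP[ub bv]; apply: semicircle_path_inj.
    by rewrite (le_trans mu)// (le_trans av).
  by rewrite (le_trans mu)// (le_trans bv).
Qed.

End path.

(** Two arcs issue from p, and the end point of neither is on the other. Together with
    the convexity of arcs this prevents p from being extremal in its component, and
    it is easier to check than that the union of A and B is an arc. *)
Definition two_sided p : Prop := exists (A B : set (knaster R)) (a b : knaster R),
  [/\ is_arc R A, is_arc R B, A p & B p] /\
  [/\ A a, B b, a <> p /\ b <> p, ~ B a & ~ A b].

Lemma interior_two_sided m r s (H : carries m r s) u :
  m - r < u < m + r -> two_sided (semicircle_path H u).
Proof.
move=> /andP[mu um]; pose g := semicircle_path H.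
have gi : inj_on (m - r) (m + r) g by exact: semicircle_path_inj.
exists (g @` `[m - r, u]), (g @` `[u, m + r]), (g (m - r)), (g (m + r)).
have mr : m - r < m + r by exact: lt_trans um.
have nE v w : m - r <= v <= m + r -> m - r <= w <= m + r -> v != w -> g v <> g w.
  by move=> vI wI /eqP vw /gi => /(_ vI wI).
split.
  split; [apply: semicircle_path_arc => //; exact: ltW|
          apply: semicircle_path_arc => //; exact: ltW| |].
    by exists u => //=; rewrite in_itv/= lexx ltW.
  by exists u => //=; rewrite in_itv/= lexx ltW.
split.
- by exists (m - r) => //=; rewrite in_itv/= lexx ltW.
- by exists (m + r) => //=; rewrite in_itv/= lexx ltW.
- split; apply: nE; rewrite ?lexx ?ltW//; first by rewrite lt_eqF.
  by rewrite gt_eqF.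
- move=> [v]; rewrite /= in_itv/= => /andP[uv vm]; apply: nE.
  + by rewrite vm (le_trans (ltW mu)).
  + by rewrite lexx ltW.
  + by rewrite gt_eqF// (lt_le_trans mu).
- move=> [v]; rewrite /= in_itv/= => /andP[mv vu]; apply: nE.
  + by rewrite mv (le_trans vu)// ltW.
  + by rewrite lexx ltW.
  + by rewrite lt_eqF// (le_lt_trans vu).
Qed.

(** What is needed to compare two semicircles that share an end point: the equation of
    the circle shows that the other end point of one is not on the other one. *)
Lemma full_semicircle m c s : s ^+ 2 = 1 -> c <> m -> carries m `|c - m| s ->
  exists (A : set (knaster R)) (a : knaster R),
    [/\ is_arc R A, val a = (2 * m - c, 0), A a,
        forall p, val p = (c, 0) -> A p &
        forall p, A p -> ((val p).1 - m) ^+ 2 + (val p).2 ^+ 2 = (c - m) ^+ 2].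
Proof.
move=> s1 cm H; set r := `|c - m| in H; pose g := semicircle_path H.
have r0 : 0 < r by rewrite normr_gt0 subr_eq0; exact/eqP.
have r2 : r ^+ 2 = (c - m) ^+ 2 by rewrite real_normK ?num_real.
have on x : (x - m) ^+ 2 = (c - m) ^+ 2 ->
    m - r <= x <= m + r /\ semicircle m r s x = (x, 0).
  move=> xE; apply: (@semicircle_on m r s (x, 0) s1 (ltW r0)) => /=.
    by rewrite mulr0.
  by rewrite expr0n addr0 xE r2.
have [xI xE] := on (2 * m - c) ltac:(by ring).
have [cI cE] := on c erefl.
exists (g @` `[m - r, m + r]), (g (2 * m - c)); split=> //.
- by apply: semicircle_path_arc => //; lra.
- move=> p pE; exists c; first by rewrite /= in_itv.
  by apply/val_inj; rewrite pE /= cE.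
- by move=> _ [u _ <-] /=; rewrite -r2; apply: semicircle_eq => //; exact: ltW.
Qed.

(** A point (x, 0) other than the origin is an end point of one upper and one lower
    semicircle. Their other end points have abscissas 1 - x and 2 m - x, where m is the
    centre of the lower one; each is off the other semicircle because x is not a
    centre and the two centres are distinct. *)
Lemma endpoint_two_sided p : cantor_ternary (val p).1 -> (val p).2 = 0 ->
  p <> knaster0 R -> two_sided p.
Proof.
case pE : (val p) => [x y] /= cx y0 pn0; rewrite {y}y0 in pE.
have x0 : 0 < x.
  rewrite lt_neqAle; have /andP[-> _] := cantor_itv cx; rewrite andbT.
  by apply: contra_notN pn0 => /eqP x0; apply/val_inj; rewrite pE -x0.
have [n [y cy xE]] := cantor_pos_block cx x0.
pose m : R := 5 / (2 * 3 ^+ n.+1).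
have x12 : x <> 1 / 2 by move=> x12; apply: (@cantor_nhalf R); rewrite -x12.
have xm : x <> m by rewrite xE; exact: block_center.
(* Equal centres would give 3 ^ n.+1 = 5. *)
have m12 : m <> 1 / 2.
  have e3 : 3 ^+ n.+1 != 0 :> R by rewrite expf_neq0.
  move=> mE; have : 3 ^+ n.+1 = 5 :> R.
    have : 3 ^+ n.+1 * m = 3 ^+ n.+1 * (1 / 2) by rewrite mE.
    rewrite (_ : _ * m = 5 / 2); first by lra.
    by rewrite /m; field.
  move=> /eqP; rewrite -natrX eqr_nat => /eqP/(congr1 (fun k => k %% 3)%N).
  by rewrite expnS modnMr.
have [A [a [aA av Aa Ax Acirc]]] :=
  full_semicircle (expr1n _ 2) x12 (upper_carries cx).
have lc := lower_carries n cy; rewrite -xE -/m in lc.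
have [B [b [aB bv Bb Bx Bcirc]]] :=
  full_semicircle (etrans (sqrrN 1) (expr1n _ 2)) xm lc.
exists A, B, a, b; split; first by split=> //; [exact: Ax|exact: Bx].
split=> //.
- by split=> /(congr1 val); rewrite pE ?av ?bv => -[]; lra.
- move=> /Bcirc; rewrite av /= expr0n addr0 => E.
  have : (1 - 2 * x) * (1 - 2 * m) = 0 by lra.
  by move=> /eqP; rewrite mulf_eq0 => /orP[]/eqP ?; [apply: x12|apply: m12]; lra.
- move=> /Acirc; rewrite bv /= expr0n addr0 => E.
  have : (2 * m - 2 * x) * (2 * m - 1) = 0 by lra.
  by move=> /eqP; rewrite mulf_eq0 => /orP[]/eqP ?; [apply: xm|apply: m12]; lra.
Qed.

(** The symmetries of the Cantor set and of its blocks exchange the two feet of a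
    semicircle, so that both feet are in the Cantor set and each is also a foot of a
    semicircle of the other half plane. *)
Lemma knaster_on_semicircle p : exists m c s,
  [/\ carries m `|c - m| s, s ^+ 2 = 1, 0 <= s * (val p).2,
     ((val p).1 - m) ^+ 2 + (val p).2 ^+ 2 = (c - m) ^+ 2 &
     cantor_ternary c /\ cantor_ternary (2 * m - c)].
Proof.
have [[p2 [c cc /same_circleE pc]]|[[//|n] _ [p2 [c [cc clh /same_circleE pc]]]]] := set_valP p.
  exists (1 / 2), c, 1; split=> //; first exact: upper_carries.
  - by rewrite expr1n.
  - by rewrite mul1r.
  - by split=> //; rewrite mulrCA divff ?mulr1 ?pnatr_eq0//; exact: cantor_sym.
have [y cy cE] := cantor_block cc clh.
exists (5 / (2 * 3 ^+ n.+1)), c, (- 1); split=> //.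
- by rewrite cE; exact: lower_carries.
- by rewrite sqrrN expr1n.
- by rewrite mulN1r oppr_ge0.
- split=> //; have [+ _] := cantor_blockI n (cantor_sym cy).
  rewrite -block_sym -cE; congr (cantor_ternary (_ - c)).
  by field; rewrite expf_neq0.
Qed.

Lemma knaster_two_sided p : p <> knaster0 R -> two_sided p.
Proof.
move=> pn0; have [m [c [s [H s1 sp pE [cc cc']]]]] := knaster_on_semicircle p.
have [p20|p2] := eqVneq (val p).2 0.
  apply: endpoint_two_sided => //; move: pE; rewrite p20 expr0n addr0 => pE.
  have /eqP : ((val p).1 - c) * ((val p).1 - (2 * m - c)) = 0 by lra.
  by rewrite mulf_eq0 !subr_eq0 => /orP[]/eqP ->.
have r2 : `|c - m| ^+ 2 = (c - m) ^+ 2 by rewrite real_normK ?num_real.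
have [|||_ pv] := @semicircle_on m `|c - m| s (val p) s1 => //.
  by rewrite pE r2.
have -> : p = semicircle_path H (val p).1 by apply/val_inj; rewrite /= pv.
apply: interior_two_sided; rewrite -ltr_distl.
rewrite -(ltr_pXn2r (n := 2)) ?nnegrE//= !real_normK ?num_real//.
by rewrite -pE ltrDl exprn_even_gt0.
Qed.

(** The upper semicircle from (0, 0) to (1, 0). *)
Lemma knaster0_arc : exists (A : set (knaster R)) (a : knaster R),
  [/\ is_arc R A, A (knaster0 R), A a & a <> knaster0 R].
Proof.
have c0 : cantor_ternary (0 : R).
  move=> n _; elim: n => [|n IH]; first by rewrite /= in_itv/= lexx ler01.
  by left; exists 0; rewrite ?mul0r.
have n12 : 0 <> 1 / 2 :> R by lra.
have [A [a [aA av Aa A0 _]]] := full_semicircle (expr1n _ 2) n12 (upper_carries c0).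
exists A, a; split=> //; first exact: A0.
by move=> /(congr1 val); rewrite av => -[]; lra.
Qed.

End semicircles.

(** * Chains of small mesh *)

Section shrinking_links.
Context {R : realType}.

Lemma le_knaster_dist (x y : knaster R) :
  `|(val x).1 - (val y).1| <= knaster_dist x y /\
  `|(val x).2 - (val y).2| <= knaster_dist x y.
Proof.
rewrite /knaster_dist /Defs.edist.
by split; rewrite -sqrtr_sqr ler_wsqrtr// ?lerDl ?lerDr sqr_ge0.
Qed.

Lemma nbhs_knaster (x : knaster R) (V : set (knaster R)) : nbhs x V ->
  exists2 e : R, 0 < e & forall y, knaster_dist x y < e -> V y.
Proof.
move=> [_ [[W oW <-] /= Wx] WV].
have /nbhs_ballP[e /= e0 eW] := open_nbhs_nbhs (conj oW Wx).
exists e => // y xy; apply: WV => /=; apply: eW.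
by have [d1 d2] := le_knaster_dist x y; split; rewrite /ball/=; exact: le_lt_trans xy.
Qed.

Lemma dist_le_mesh (T : Type) (dist : T -> T -> R) (d : seq (set T)) i x y :
  (i < size d)%N -> nth set0 d i x -> nth set0 d i y ->
  ((dist x y)%:E <= mesh dist d)%E.
Proof.
move=> ilt ix iy; apply: (@le_trans _ _ (diam dist (nth set0 d i))).
  by apply: ereal_sup_ubound; exists x, y.
elim: d i ilt ix iy => [|A d IH] [|i]// ilt ix iy; rewrite /mesh big_cons le_max.
  by rewrite lexx.
by apply/orP; right; exact: IH.
Qed.

Lemma mesh_shrinking (D : nat -> seq (set (knaster R))) :
  mesh (@knaster_dist R) (D n) @[n --> \oo] --> 0%E -> shrinking D.
Proof.
move=> Dmesh x V /nbhs_knaster[e e0 eV].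
have small : \forall n \near \oo, (mesh (@knaster_dist R) (D n) < e%:E)%E.
  apply: (Dmesh [set z | (z < e%:E)%E]).
  by apply: open_ereal_lt'; rewrite lte_fin.
apply: filterS small => n small i ilt ix y iy; apply: eV.
by rewrite -lte_fin; apply: le_lt_trans small; exact: dist_le_mesh iy.
Qed.

End shrinking_links.

(** * Arc components of the Knaster continuum *)

Section non_extremal.
Context {R : realType} {le : knaster R -> knaster R -> Prop}.
Context (lin : linear_order le) (conv : arc_convex le).
Local Notation lt := (strict le).
Local Notation joined := (arc_component R).

(** If a and b were on the same side of p, then the one nearer to p would be on the
    arc from p to the other by convexity. *)
Lemma two_sided_between p : two_sided p ->
  (exists2 q, joined p q & lt p q) /\ (exists2 q, joined p q & lt q p).
Proof.
have hK := @knaster_hausdorff R.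
move=> [A [B [a [b [[aA aB Ap Bp] [Aa Bb [nap nbp] nBa nAb]]]]]].
have ja : joined p a by right; exists A.
have jb : joined p b by right; exists B.
have [ap|pa] := lin_leP lin a p; have [bp|pb] := lin_leP lin b p.
- by case: (lin_total lin a b) => ab; exfalso;
    [apply: nAb; exact: (is_arc_convex hK conv aA Aa Ap ab bp)|
     apply: nBa; exact: (is_arc_convex hK conv aB Bb Bp ab ap)].
- by split; [exists b|exists a].
- by split; [exists a|exists b].
- by case: (lin_total lin a b) => ab; exfalso;
    [apply: nBa; exact: (is_arc_convex hK conv aB Bp Bb pa.1 ab)|
     apply: nAb; exact: (is_arc_convex hK conv aA Ap Aa pb.1 ab)].
Qed.

End non_extremal.

Lemma homeomorphic_refl (S : topologicalType) : homeomorphic S S.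
Proof. by exists id, id; split=> // x; exact: cvg_id. Qed.

Theorem theorem6p4 (R : realType) (U : set_system nat)
    (U_ultra : UltraFilter U) (U_nonprincipal : nonprincipal U)
    (D : nat -> seq (set (knaster R)))
    (D_chain : forall n, is_chain (D n))
    (D_cover : forall n, chain_covers (D n))
    (D_first : forall n, nth set0 (D n) 0 (knaster0 R))
    (D_mesh : mesh (@knaster_dist R) (D n) @[n --> \oo] --> 0%E) :
  exists (X : set_type (arc_components R (knaster R)) -> topologicalType)
         (h : order_space (ultra_le U D) -> {i & X i}),
    [/\ homeomorphism h,
        (forall x : knaster R, val (tag (h x)) = arc_component R x),
        (forall i : set_type (arc_components R (knaster R)),
           val i (knaster0 R) ->
           homeomorphic (X i) (set_type (`[0, 1[ : set R))) &
        (forall i : set_type (arc_components R (knaster R)),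
           ~ val i (knaster0 R) ->
           homeomorphic (X i) (set_type (`]0, 1[ : set R)))].
Proof.
have hK := @knaster_hausdorff R.
have cofU := nonprincipal_cofinite U_ultra U_nonprincipal.
have shrD := mesh_shrinking D_mesh.
set le := ultra_le U D.
have lin : linear_order le by apply: ultra_le_linear.
have conv : arc_convex le.
  by move=> A x y w; exact: connected_ultra_convex.
have cval : continuous (val : knaster R -> (R * R)%type) by exact: continuous_val.
have ival : injective (val : knaster R -> (R * R)%type) by exact: val_inj.
pose o := knaster0 R.
have omin x : le o x.
  rewrite /le /ultra_le; apply: filterE => n.
  have [i ilt ix] := D_cover n x.
  by exists 0%N, i; split=> //; exact: D_first.
have comp_ex (x : knaster R) : arc_components R (knaster R) (arc_component R x).
  by exists x.
pose comp x := in_set (comp_ex x).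
have compE x y : comp x = comp y <-> arc_component R x y.
  rewrite (joinedP hK lin conv); split=> [/(congr1 val)//|xy].
  exact/val_inj.
pose J (i : set_type (arc_components R (knaster R))) : set R :=
  if `[< val i o >] then `[0, 1[%classic else `]0, 1[%classic.
have J_sub i r : J i r -> 0 <= r < 1.
  rewrite /J; case: ifP => _; rewrite /= in_itv/= => /andP[r0 ->].
    by rewrite r0.
  by rewrite ltW.
have trans := @joined_trans R _ hK _ lin conv.
have nomax x : exists2 y, arc_component R x y & strict le x y.
  have [->|/knaster_two_sided/(two_sided_between lin conv)[]//] := pselect (x = o).
  have [A [a [aA Ao Aa ao]]] := @knaster0_arc R.
  by exists a; [right; exists A|split=> // /esym].
have nomin x : x <> o -> exists2 y, arc_component R x y & strict le y x.
  by move=> /knaster_two_sided/(two_sided_between lin conv)[].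
have chart_ex i : exists g : R -> knaster R,
    increasing_on le (J i) g /\ g @` J i = val i.
  rewrite /J; case: asboolP => [io|nio].
    have iE : val i = arc_component R o.
      have [x _ xi] := set_valP i; rewrite -xi in io *.
      by apply/esym/(joinedP hK lin conv)/joined_sym.
    have [|g [gI gE]] := component_ray hK lin conv cval ival (@joined_refl R _ o).
      by move=> x ox; have [y xy lxy] := nomax x; exists y => //; exact: trans xy.
    exists g; split=> //; rewrite gE iE predeqE => x; split=> [[]//|ox].
    by split.
  have [x0 _ xi] := set_valP i; rewrite -xi in nio *.
  apply: (component_line hK lin conv cval ival) => x x0x.
    by have [y xy lxy] := nomax x; exists y => //; exact: trans xy.
  have [|y xy lxy] := nomin x; first by move=> xo; apply: nio; rewrite -xo.
  by exists y => //; exact: trans xy.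
have [chart chartP] := choice chart_ex.
have chart_comp i r : J i r -> comp (chart i r) = i.
  move=> Jr; have [x _ xi] := set_valP i.
  have : val i (chart i r) by rewrite -(chartP i).2; exists r.
  by rewrite -xi => /compE <-; exact/val_inj.
have [|||||||h [hh hc]] := @sum_of_intervals_homeo R (knaster R) le lin _ comp J chart.
- move=> x y w /compE xy xw wy; apply/esym/compE.
  by have [] := joined_convex hK lin conv xy xw wy.
- by move=> i; rewrite /J; case: asboolP => _; exact: interval_is_interval.
- by move=> i; exact: (chartP i).1.
- exact: chart_comp.
- move=> x; have : val (comp x) x by left.
  by rewrite -(chartP (comp x)).2 => -[r]; exists r.
- move=> i r Jr; exists ((r + 1) / 2); last by have /andP[_ r1] := J_sub i r Jr; lra.
  move: Jr; rewrite /J; case: asboolP => _; rewrite /= !in_itv/= => /andP[r0 r1];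
    apply/andP; split; lra.
(* Only the component of the origin has a least parameter, namely that of the
   origin. *)
- move=> i r Jr; have [r0|rn0] := eqVneq r 0; [left=> y|right].
    move: (Jr); rewrite r0 {1}/J; case: asboolP => [io _|_]; last first.
      by rewrite /= in_itv/= ltxx.
    have : val i o by [].
    rewrite -(chartP i).2 => -[s Js so].
    have [s00|sn0] := eqVneq s 0; first by rewrite -s00 so; exact: omin.
    have s0 : 0 < s by rewrite lt_neqAle eq_sym sn0; have /andP[] := J_sub i s Js.
    have := (chartP i).1 r s Jr Js; rewrite r0 so => /(_ s0)/(lin_lt_le lin).
    by case; exact: omin.
  exists (r / 2); last first.
    have /andP[r0 _] := J_sub i r Jr.
    by rewrite gtr_pMr ?invf_lt1 ?ltr1n// lt_neqAle eq_sym rn0.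
  move: Jr rn0; rewrite /J; case: asboolP => _;
    rewrite /= !in_itv/= => /andP[r0 r1] rn0.
    by apply/andP; split; lra.
  by apply/andP; split; lra.
exists (fun i => set_type (J i)), h; split=> //.
- by move=> x; rewrite hc.
- by move=> i io; rewrite /J asboolT//; exact: homeomorphic_refl.
- by move=> i io; rewrite /J asboolF//; exact: homeomorphic_refl.
Qed.
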